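(* Let $n\ge 2$ be an integer, let $p>n$, and put $\beta=1-n/p$. Let $E_p$ be a Banach space such that: (i) $E_p$ is adequate to the Navier-Stokes problem; (ii) the norm $\|\cdot\|_{E_p}$ has scaling degree equal to $-n/p$; (iii) there exists $q>0$ such that the operator $e^{t\Delta}:E_p\to L^q$ is bounded for every $t>0$. Then there is a constant $C>0$ depending only on $E_p$ (and $n,p$) such that the following holds. Let $u,v\in\chi$ be two global in time (mild) solutions of the Navier-Stokes system corresponding to initial conditions $u_0,v_0\in BE_p^\beta$ respectively, and suppose that $\|u\|_\chi\le M$ and $\|v\|_\chi\le M$ for some constant $M>0$. Let $w_0=u_0-v_0$ and $w(t)=u(t)-v(t)$. Then $$\|w(t)\|_{E_p}\le\left(\|w_0\|_{BE_p^\beta}+4CM^2\right)t^{-\beta/2}\qquad\text{for all }t>0.$$ That is, $\|u(t)-v(t)\|_{E_p}$ goes asymptotically to $0$ like $t^{-\beta/2}$ (is $O(t^{-\beta/2})$) as $t\to\infty$.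
   Context: Notation. $\mathcal S$ and $\mathcal S'$ are the Schwartz space and the space of tempered distributions on $\mathbb R^n$ (componentwise for vector- or matrix-valued objects). $S(t)=e^{t\Delta}$ is the heat semigroup, i.e. convolution with $(4\pi t)^{-n/2}e^{-|x|^2/(4t)}$. $\mathbf P$ is the projection onto solenoidal (divergence-free) vector fields, $\mathbf P(u_1,\dots,u_n)=(u_1-R_1\sigma,\dots,u_n-R_n\sigma)$, where $R_j$ is the Riesz transform with symbol $\xi_j/|\xi|$ and $\sigma=R_1u_1+\dots+R_nu_n$. For vector fields $u,v$, $u\otimes v=(u_iv_j)_{i,j}$, $\nabla(u\otimes v)$ is the vector with components $\sum_i\partial_i(u_iv_j)$, $B(u,v)=\mathbf P\nabla(u\otimes v)$, and $e^{t\Delta}B(u,v)=\mathbf P\nabla S(t)(u\otimes v)$. Navier-Stokes problem: $u_t-\Delta u+(u\cdot\nabla)u+\nabla p=0$, $\nabla\cdot u=0$, $u(0)=u_0$ on $\mathbb R^n\times[0,\infty)$ (here $p$ is the pressure), where $\nabla\cdot u_0=0$. A solution always means a mild solution, i.e. a solution of $$u(t)=S(t)u_0-\int_0^t\mathbf P\nabla S(t-\tau)(u\otimes u)(\tau)\,d\tau,$$ with integrals in the sense of Bochner; it is global in time if this holds for all $t>0$. Functional, translation invariant space. A Banach space $(E,\|\cdot\|_E)$ is functional and translation invariant if: $\mathcal S\subset E\subset\mathcal S'$ with both inclusions continuous; for every $f\in E$ the map $\mathbb R^n\ni y\mapsto\tau_yf\in E$, $\tau_yf(x)=f(x+y)$,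 is Bochner measurable with respect to Lebesgue measure; and $\|\tau_yf\|_E=\|f\|_E$ for all $f\in E$, $y\in\mathbb R^n$. Adequate space. $(E,\|\cdot\|_E)$ is adequate to the Navier-Stokes problem if it is a functional and translation invariant Banach space and, for all $f,g\in E$, the product $f\otimes g$ is well defined as a tempered distribution and, moreover, there exist $T_0>0$ and a positive function $\omega\in L^1(0,T_0)$ such that $\|\mathbf P\nabla S(\tau)(f\otimes g)\|_E\le\omega(\tau)\|f\|_E\|g\|_E$ for all $f,g\in E$ and $\tau\in(0,T_0)$. Scaling degree. For $\lambda>0$, $f_\lambda(x)=f(\lambda x)$ (extended to $\mathcal S'$ in the usual way). For a Banach space $E$ continuously imbedded in $\mathcal S'$, the norm has scaling degree $k$ if $\|f_\lambda\|_E=\lambda^k\|f\|_E$ for all $\lambda>0$ and all $f\in E$ such that $f_\lambda\in E$. The space $BE^\beta$. For $\beta\ge0$ and $E$ continuously imbedded in $\mathcal S'$, $BE^\beta=\{f\in\mathcal S':\|f\|_{BE^\beta}=\sup_{t>0}t^{\beta/2}\|S(t)f\|_E<\infty\}$; $BE_p^\beta$ is this space for $E=E_p$. The space $\chi$. $\mathcal C([0,\infty),BE_p^\beta)$ denotes the set of measurable, essentially bounded functions $u:[0,\infty)\to BE_p^\beta$ such that $u(t)\to u(0)$ as $t\searrow0$ in the topology of $\mathcal S'$. Then $\chi=\mathcal C([0,\infty),BE_p^\beta)\cap\{u:(0,\infty)\to E_p:\sup_{t>0}t^{\beta/2}\|u(t)\|_{E_p}<\infty\}$, with norm $\|u\|_\chi=\max\{\sup_{t>0}\|u(t)\|_{BE_p^\beta},\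 \sup_{t>0}t^{\beta/2}\|u(t)\|_{E_p}\}$.
   Formalization: The formal theorem also assumes that E_p is stable under dilations (f in E_p and λ>0 imply f_λ in E_p); the stated scaling degree only constrains those f with f_λ in E_p, and without this the claim fails for some artificial spaces. *)

(* Defs.v *)
From HB Require Import structures.
From mathcomp Require Import all_boot all_order all_algebra.
From mathcomp Require Import complex.
From mathcomp Require Import all_classical all_reals all_analysis.

Set Implicit Arguments.
Unset Strict Implicit.
Unset Printing Implicit Defensive.

Import Order.TTheory GRing.Theory Num.Theory.
Import numFieldNormedType.Exports.

Local Open Scope classical_set_scope.
Local Open Scope ring_scope.
Local Open Scope complex_scope.

(** * Lebesgue measure on R^n

    The library has no n-dimensional Lebesgue measure; it is built on
    [n.-tuple R] (with the product sigma-algebra) as an iterated product. *)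

Section lebesgue_cons.
Context {R : realType} (n : nat).
Variable m : {sigma_finite_measure set (n.-tuple (measurableTypeR R)) -> \bar R}.

Definition consT (x : measurableTypeR R * n.-tuple (measurableTypeR R)) :
  n.+1.-tuple (measurableTypeR R) := [tuple of x.1 :: x.2].

Lemma measurable_consT : measurable_fun setT consT.
Proof. exact: measurable_cons. Qed.

Lemma measurable_consT_image A B : measurable A -> measurable B ->
  measurable (consT @` (A `*` B)).
Proof.
move=> mA mB.
pose b (y : n.+1.-tuple (measurableTypeR R)) : n.-tuple (measurableTypeR R) :=
  [tuple of behead y].
have -> : consT @` (A `*` B) =
    ((fun y => tnth y ord0) @^-1` A) `&` (b @^-1` B).
  apply/seteqP; split=> [y [[a t] /= [Aa Bt] <-]|y [/= Ay By]].
    by split => //=; rewrite (_ : b _ = t)//; apply/val_inj.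
  exists (tnth y ord0, b y) => //.
  by rewrite /consT /= [RHS]tuple_eta; apply/val_inj.
apply: measurableI; rewrite -[X in measurable X]setTI.
- exact: measurable_tnth.
- exact: measurable_behead.
Qed.

Definition lebesgue_cons : set (n.+1.-tuple (measurableTypeR R)) -> \bar R :=
  pushforward (lebesgue_measure \x m)%E consT.

Let mu0 : {measure set (n.+1.-tuple (measurableTypeR R)) -> \bar R} :=
  measure_function_pushforward__canonical__measure_function_Measure
    (lebesgue_measure \x m)%E measurable_consT.

HB.instance Definition _ := isMeasure.Build _ _ _ lebesgue_cons
  (measure0 mu0) (measure_ge0 mu0) (@measure_semi_sigma_additive _ _ _ mu0).

Lemma lebesgue_cons_sigma_finite : sigma_finite setT lebesgue_cons.
Proof.
have /sigma_finiteP[F [TF ndF Foo]] :=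
  sigma_finiteT (lebesgue_measure : {sigma_finite_measure set _ -> \bar R}).
have /sigma_finiteP[G [TG ndG Goo]] := sigma_finiteT m.
exists (fun k => consT @` (F k `*` G k)).
  rewrite predeqE => y; split=> // _.
  pose b := [tuple of behead y] : n.-tuple (measurableTypeR R).
  have : [set: measurableTypeR R] (tnth y ord0) by [].
  rewrite TF => -[i _ Fi].
  have : [set: n.-tuple (measurableTypeR R)] b by [].
  rewrite TG => -[j _ Gj].
  exists (maxn i j) => //; exists (tnth y ord0, b).
    split => /=.
    - by move: Fi; exact/subsetPset/ndF/leq_maxl.
    - by move: Gj; exact/subsetPset/ndG/leq_maxr.
  by rewrite /consT /= [RHS]tuple_eta; apply/val_inj.
move=> k; have [mF Fk] := Foo k; have [mG Gk] := Goo k.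
split; first exact: measurable_consT_image.
rewrite /lebesgue_cons /pushforward (_ : _ @^-1` _ = F k `*` G k).
  by rewrite product_measure1E// lte_mul_pinfty// ge0_fin_numE.
apply/seteqP; split=> [[x t] /= [[x' t'] /= [Fx Gt]]|[x t] /= xt]; last first.
  by exists (x, t).
by move=> /(congr1 val) /= [<- tt']; split => //; rewrite -(val_inj tt').
Qed.

HB.instance Definition _ := Measure_isSigmaFinite.Build _ _ _ lebesgue_cons
  lebesgue_cons_sigma_finite.

End lebesgue_cons.

Fixpoint lebesgue_tuple (R : realType) (n : nat) :
    {sigma_finite_measure set (n.-tuple (measurableTypeR R)) -> \bar R} :=
  match n with
  | 0 => dirac ([tuple] : 0.-tuple (measurableTypeR R))
  | n'.+1 => lebesgue_cons (lebesgue_tuple R n')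
  end.

(** * Schwartz functions and tempered distributions on R^n (complex-valued) *)

Definition rnorm (R : realType) (V : normedZmodType R[i]) (v : V) : R :=
  complex.Re `|v|.

Section distributions.
Variables (R : realType) (n : nat).
Local Notation C := R[i].
Local Notation Rn := 'rV[R]_n.

Definition dotv (x y : Rn) : R := \sum_(i < n) x 0 i * y 0 i.
Definition enorm (x : Rn) : R := Num.sqrt (dotv x x).

Definition of_tuple (t : n.-tuple (measurableTypeR R)) : Rn :=
  \row_(i < n) (tnth t i : R).

Definition cintegral (f : Rn -> C) : C :=
  (\int[lebesgue_tuple R n]_(t in setT) complex.Re (f (of_tuple t)))%R +i*
  (\int[lebesgue_tuple R n]_(t in setT) complex.Im (f (of_tuple t)))%R.

Definition cintegrable (f : Rn -> C) : Prop :=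
  (lebesgue_tuple R n).-integrable setT
    (fun t => (complex.Re (f (of_tuple t)))%:E) /\
  (lebesgue_tuple R n).-integrable setT
    (fun t => (complex.Im (f (of_tuple t)))%:E).

Definition has_partial (i : 'I_n) (f : Rn -> C) : Prop :=
  forall x, derivable (fun y => complex.Re (f y)) x (delta_mx 0 i) /\
            derivable (fun y => complex.Im (f y)) x (delta_mx 0 i).

Definition partial (i : 'I_n) (f : Rn -> C) : Rn -> C := fun x =>
  ('D_(delta_mx 0 i) (fun y => complex.Re (f y)) x) +i*
  ('D_(delta_mx 0 i) (fun y => complex.Im (f y)) x).

Definition partials (s : seq 'I_n) (f : Rn -> C) : Rn -> C :=
  foldr partial f s.

(* Since all the iterated partial derivatives are required to be bounded, they
   are automatically continuous. *)
Definition schwartz (f : Rn -> C) : Prop :=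
  (forall s i, has_partial i (partials s f)) /\
  (forall s k, exists B : R, forall x,
     (1 + enorm x) ^+ k * rnorm (partials s f x) <= B).

(* [B] dominates the [N]-th of the seminorms that define the topology. *)
Definition schwartz_le (N : nat) (f : Rn -> C) (B : R) : Prop :=
  forall s x, (size s <= N)%N ->
    (1 + enorm x) ^+ N * rnorm (partials s f x) <= B.

Definition bump (f : Rn -> C) : Prop :=
  schwartz f /\ exists r : R, forall x, r < enorm x -> f x = 0.

(* Distributions are functionals on all functions, of which only the values on
   Schwartz functions are meaningful; they are compared by [deq]. *)
Definition distr := (Rn -> C) -> C.

Definition deq (u v : distr) : Prop :=
  forall phi, schwartz phi -> u phi = v phi.

Definition tempered (u : distr) : Prop :=
  (forall (a : C) phi psi, schwartz phi -> schwartz psi ->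
     u (fun x => a * phi x + psi x) = a * u phi + u psi) /\
  (exists (N : nat) (K : R), forall phi B, schwartz phi ->
     schwartz_le N phi B -> rnorm (u phi) <= K * B).

(* The distribution defined by a function. *)
Definition regular (f : Rn -> C) : distr :=
  fun phi => cintegral (fun x => f x * phi x).

Definition represents (f : Rn -> C) (u : distr) : Prop :=
  [/\ measurable_fun setT (fun t => complex.Re (f (of_tuple t))),
      measurable_fun setT (fun t => complex.Im (f (of_tuple t))) &
      forall phi, schwartz phi ->
        cintegrable (fun x => f x * phi x) /\ u phi = regular f phi].

Definition translate (y : Rn) (u : distr) : distr :=
  fun phi => u (fun x => phi (x - y)).

Definition dilate (lam : R) (u : distr) : distr :=
  fun phi => (lam ^- n)%:C * u (fun x => phi (lam^-1 *: x)).

Definition dpartial (i : 'I_n) (u : distr) : distr :=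
  fun phi => - u (partial i phi).

Definition gauss (t : R) : Rn -> C := fun x =>
  ((4 * pi * t) `^ (- (n%:R / 2)) * expR (- dotv x x / (4 * t)))%:C.

Definition convolution (f g : Rn -> C) : Rn -> C :=
  fun x => cintegral (fun y => f (x - y) * g y).

(* Convolution of a tempered distribution with the even function [gauss t]. *)
Definition heat (t : R) (u : distr) : distr :=
  fun phi => u (convolution (gauss t) phi).

(** ** Riesz transforms and the projection on solenoidal fields *)

Definition expi (a : R) : C := cos a +i* sin a.

Definition fourier (phi : Rn -> C) : Rn -> C :=
  fun xi => cintegral (fun x => expi (- dotv x xi) * phi x).

Definition inv_fourier (psi : Rn -> C) : Rn -> C :=
  fun x => ((2 * pi) ^- n)%:C *
    cintegral (fun xi => expi (dotv x xi) * psi xi).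

(* The Fourier multiplier with symbol [m], by duality:
   <m(D) u, phi> = <u, m(-D) phi>. *)
Definition multiplier (m : Rn -> C) (u : distr) : distr :=
  fun phi => u (inv_fourier (fun xi => m (- xi) * fourier phi xi)).

Definition riesz_symbol (j : 'I_n) : Rn -> C :=
  fun xi => (xi 0 j / enorm xi)%:C.

(* The symbol xi_j / |xi| is singular at the origin, so that it does not
   multiply every tempered distribution.  [v] is the j-th Riesz transform of [u]
   when the symbol can be applied to the frequencies of size at least eps of
   [u] and the result tends to [v] as eps -> 0, for every smooth cutoff. *)
Definition is_riesz (j : 'I_n) (u v : distr) : Prop :=
  tempered v /\
  forall chi : Rn -> C, bump chi ->
    (exists2 r : R, 0 < r & forall xi, enorm xi < r -> chi xi = 1) ->
    forall phi, schwartz phi ->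
      (fun eps : R => rnorm (multiplier
         (fun xi => riesz_symbol j xi * (1 - chi (eps^-1 *: xi))) u phi
         - v phi)) @ 0^'+ --> (0 : R).

Definition is_leray (u w : 'I_n -> distr) : Prop :=
  exists r s : 'I_n -> distr,
    [/\ forall k, is_riesz k (u k) (r k),
        forall j, is_riesz j (fun phi => \sum_(k < n) r k phi) (s j) &
        forall j, deq (w j) (fun phi => u j phi - s j phi)].

(* w = P nabla S(t) F, where nabla F has components sum_i d_i F_ij. *)
Definition is_leray_div_heat (t : R) (F : 'I_n -> 'I_n -> distr)
    (w : 'I_n -> distr) : Prop :=
  is_leray (fun j phi => \sum_(i < n) dpartial i (heat t (F i j)) phi) w.

Definition div_free (u : 'I_n -> distr) : Prop :=
  forall phi, schwartz phi -> \sum_(i < n) dpartial i (u i) phi = 0.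

(** ** Products of distributions *)

Definition mollify (rho : Rn -> C) (eps : R) (u : distr) : Rn -> C :=
  fun x => u (fun y => (eps ^- n)%:C * rho (eps^-1 *: (x - y))).

(* The product of two distributions is the limit of the products of their
   regularizations, when it exists and does not depend on the mollifier. *)
Definition is_product (u v F : distr) : Prop :=
  tempered F /\
  forall rho : Rn -> C, bump rho -> cintegral rho = 1 ->
    forall phi, schwartz phi ->
      (fun eps : R => rnorm (regular
         (fun x => mollify rho eps u x * mollify rho eps v x) phi - F phi))
        @ 0^'+ --> (0 : R).

Definition is_tensor (u v : 'I_n -> distr)
    (F : 'I_n -> 'I_n -> distr) : Prop :=
  forall i j, is_product (u i) (v j) (F i j).

End distributions.

(** * Bochner measurability and integral *)

Section bochner.
Variables (d : measure_display) (T : measurableType d) (R : realType).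
Variable mu : {measure set T -> \bar R}.

(* [s] lists pairs (A, a) standing for the function sum_(A, a) a 1_A. *)
Definition simple_fun (V : nmodType) (s : seq (set T * V)) (x : T) : V :=
  \sum_(Aa <- s) (if x \in Aa.1 then Aa.2 else 0).

(* The norm [N] is +oo outside the Banach space under consideration. *)
Definition bochner_measurable (D : set T) (V : zmodType) (N : V -> \bar R)
    (f : T -> V) : Prop :=
  exists s : nat -> seq (set T * V),
    (forall k Aa, Aa \in s k -> measurable Aa.1 /\ (N Aa.2 < +oo)%E) /\
    {ae mu, forall x, D x ->
       (fun k => N (f x - simple_fun (s k) x)) @ \oo --> (0 : \bar R)%E}.

Definition bochner_integral (D : set T) (V : normedModType R[i])
    (f : T -> V) (I : V) : Prop :=
  exists s : nat -> seq (set T * V),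
    [/\ forall k Aa, Aa \in s k ->
          [/\ measurable Aa.1, Aa.1 `<=` D & (mu Aa.1 < +oo)%E],
        {ae mu, forall x, D x ->
          (fun k => rnorm (f x - simple_fun (s k) x)) @ \oo --> (0 : R)},
        (fun k => \int[mu]_(x in D) (rnorm (f x - simple_fun (s k) x))%:E)%E
          @ \oo --> (0 : \bar R)%E &
        (fun k => rnorm (I - \sum_(Aa <- s k) (fine (mu Aa.1))%:C *: Aa.2))
          @ \oo --> (0 : R)].

End bochner.

(** * Banach spaces of distributions

    A Banach space between S and S' is a Banach space [E] together with its
    inclusion [incl : E -> distr R n]. *)

Section spaces.
Variables (R : realType) (n : nat) (E : completeNormedModType R[i]).
Variable incl : E -> distr R n.
Local Notation Rn := 'rV[R]_n.

(* The norm of E as a function on distributions, equal to +oo outside E. *)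
Definition normE (u : distr R n) : \bar R :=
  ereal_inf [set (rnorm e)%:E | e in [set e : E | deq (incl e) u]].

(* S' carries its weak-* topology. *)
Definition imbedded : Prop :=
  [/\ forall (a : R[i]) e f,
        deq (incl (a *: e + f)) (fun phi => a * incl e phi + incl f phi),
      forall e f, deq (incl e) (incl f) -> e = f,
      forall e, tempered (incl e) &
      forall phi, schwartz phi -> exists K : R, forall e,
        rnorm (incl e phi) <= K * rnorm e].

Definition functional_translation_invariant : Prop :=
  [/\ imbedded,
      exists (N : nat) (K : R), forall phi, schwartz phi ->
        exists2 e, deq (incl e) (regular phi) &
          forall B, schwartz_le N phi B -> rnorm e <= K * B &
      forall e, exists tau : Rn -> E,
        (forall y, deq (incl (tau y)) (translate y (incl e)) /\
                   rnorm (tau y) = rnorm e) /\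
        bochner_measurable (lebesgue_tuple R n) setT
          (fun v : E => (rnorm v)%:E) (fun t => tau (of_tuple t))].

(* Norm of a vector field: the largest of the norms of its components. *)
Definition vnorm (N : distr R n -> \bar R)
    (u : 'I_n -> distr R n) : \bar R :=
  \big[maxe/0%E]_(i < n) N (u i).

Definition in_E (u : 'I_n -> distr R n) : Prop :=
  (vnorm normE u < +oo)%E.

Definition adequate : Prop :=
  functional_translation_invariant /\
  (forall f g : 'I_n -> distr R n, in_E f -> in_E g ->
     exists F, is_tensor f g F) /\
  exists (T0 : R) (omega : R -> R),
    [/\ 0 < T0,
        forall tau, 0 < tau < T0 -> 0 < omega tau,
        lebesgue_measure.-integrable `]0, T0[%classic (EFin \o omega) &
        forall f g F tau, in_E f -> in_E g -> is_tensor f g F ->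
          0 < tau < T0 ->
          (exists w, is_leray_div_heat tau F w) /\
          forall w, is_leray_div_heat tau F w ->
            (vnorm normE w <=
               (omega tau)%:E * vnorm normE f * vnorm normE g)%E].

Definition scaling_degree (k : R) : Prop :=
  forall (lam : R) (e e' : E), 0 < lam ->
    deq (incl e') (dilate lam (incl e)) -> rnorm e' = lam `^ k * rnorm e.

(* [scaling_degree] says nothing about an f in E when f_lam is not in E. *)
Definition dilation_stable : Prop :=
  forall (lam : R) (e : E), 0 < lam ->
    exists e' : E, deq (incl e') (dilate lam (incl e)).

(* S(t) is bounded from E to L^q. *)
Definition heat_bounded_Lq (q t : R) : Prop :=
  exists K : R, forall e : E, exists2 g : Rn -> R[i],
    represents g (heat t (incl e)) &
    (Lnorm (lebesgue_tuple R n) q%:E (fun x => (rnorm (g (of_tuple x)))%:E)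
       <= (K * rnorm e)%:E)%E.

(** ** The space BE^beta, mild solutions and the space chi *)

Definition normBE (beta : R) (u : distr R n) : \bar R :=
  ereal_sup [set ((t `^ (beta / 2))%:E * normE (heat t u))%E
            | t in [set t : R | 0 < t]].

Definition in_BE (beta : R) (u : 'I_n -> distr R n) : Prop :=
  (forall i, tempered (u i)) /\ (vnorm (normBE beta) u < +oo)%E.

Definition mild_solution (u0 : 'I_n -> distr R n)
    (u : R -> 'I_n -> distr R n) : Prop :=
  forall t : R, 0 < t ->
    exists (F : R -> 'I_n -> 'I_n -> distr R n)
           (h : R -> 'I_n -> E) (I : 'I_n -> E),
      [/\ forall tau, 0 < tau < t ->
            is_tensor (u tau) (u tau) (F tau) /\
            is_leray_div_heat (t - tau) (F tau) (fun i => incl (h tau i)),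
          forall i, bochner_integral lebesgue_measure `]0, t[%classic
            (fun tau => h tau i) (I i) &
          forall i, deq (u t i) (fun phi => heat t (u0 i) phi - incl (I i) phi)].

Definition global_solution (u0 : 'I_n -> distr R n)
    (u : R -> 'I_n -> distr R n) : Prop :=
  [/\ div_free u0, forall i, deq (u 0 i) (u0 i) & mild_solution u0 u].

(* sup_(t > 0) t^(beta / 2) ||u(t)||_E *)
Definition weighted_norm (beta : R) (u : R -> 'I_n -> distr R n) :
    \bar R :=
  ereal_sup [set ((t `^ (beta / 2))%:E * vnorm normE (u t))%E
            | t in [set t : R | 0 < t]].

Definition norm_chi (beta : R) (u : R -> 'I_n -> distr R n) : \bar R :=
  maxe (ereal_sup [set vnorm (normBE beta) (u t) | t in [set t : R | 0 < t]])
       (weighted_norm beta u).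

Definition in_chi (beta : R) (u : R -> 'I_n -> distr R n) : Prop :=
  [/\ forall t, 0 <= t -> in_BE beta (u t),
      forall i, bochner_measurable lebesgue_measure [set t : R | 0 <= t]
        (normBE beta) (fun t => u t i),
      exists M : R, {ae lebesgue_measure, forall t : R, 0 <= t ->
        (vnorm (normBE beta) (u t) <= M%:E)%E},
      forall i phi, schwartz phi ->
        (fun t : R => rnorm (u t i phi - u 0 i phi)) @ 0^'+ --> (0 : R) &
      (forall t, 0 < t -> in_E (u t)) /\ (weighted_norm beta u < +oo)%E].

End spaces.

(* Main.v *)
(* Write k = n/p.  By Duhamel's formula w(t) is the heat flow of w_0, of norm at
   most ||w_0||_{BE} t^{-beta/2}, minus the difference of two Bochner integrals,
   which are estimated separately.  Dilation by lam commutes with the product, with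
   P and, up to rescaling the time, with S(t); so the estimate of [adequate] at the
   single time T0/2 gives, by the scaling degree -k,
   ||P nabla S(s)(f (x) f)||_E <= K s^{-(1+k)/2} ||f||_E^2 for all s > 0.
   As ||u(tau)||_E <= M tau^{-beta/2}, each integral has norm at most
   K M^2 \int_0^t (t-tau)^{-(1+k)/2} tau^{-beta} dtau <= K' M^2 t^{-beta/2}.

   No Fourier analysis is needed: the operators are transported by dilation through
   identities between functionals that hold on all functions, Schwartz or not. *)

Require Import Defs.
From HB Require Import structures.
From mathcomp Require Import all_boot all_order all_algebra.
From mathcomp Require Import complex.
From mathcomp Require Import all_classical all_reals all_analysis.
From mathcomp Require Import measurable_realfun ring lra.

Set Implicit Arguments.
Unset Strict Implicit.
Unset Printing Implicit Defensive.

Import Order.TTheory GRing.Theory Num.Theory.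
Import numFieldNormedType.Exports.

Local Open Scope classical_set_scope.
Local Open Scope ring_scope.
Local Open Scope complex_scope.

(** * Scaling of integrals over R^n *)

Section lower_integral_sup.
Local Open Scope ereal_scope.
Context d (T : measurableType d) (R : realType).
Variable mu : {measure set T -> \bar R}.
Import HBNNSimple.

(* The integral of a nonnegative function, measurable or not, is the supremum of
   the integrals of the simple functions below it. *)
Lemma le_lower_integral (D : set T) (f g : T -> \bar R) :
  (forall x, D x -> 0 <= f x) -> (forall x, D x -> f x <= g x) ->
  \int[mu]_(x in D) f x <= \int[mu]_(x in D) g x.
Proof.
move=> f0 fg; have g0 x (Dx : D x) : 0 <= g x := le_trans (f0 _ Dx) (fg _ Dx).
rewrite !ge0_integralE//; apply: le_ereal_sup => _ [h /= hf <-]; exists h => //= x.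
apply: le_trans (hf x) _; rewrite /patch; case: ifPn => //.
by rewrite inE; exact: fg.
Qed.

(** An upper bound on the integral of an arbitrary nonnegative function only has to be checked on
    its measurable minorants, to which the usual change of variables applies. *)
Lemma lower_integral_ge (f : T -> \bar R) (M : \bar R) :
  (forall x, 0 <= f x) ->
  (forall h : T -> R, measurable_fun setT h -> (forall x, (0 <= h x)%R) ->
    (forall x, (h x)%:E <= f x) -> \int[mu]_x (h x)%:E <= M) ->
  \int[mu]_x f x <= M.
Proof.
move=> f0 fM; rewrite ge0_integralTE//; apply: ge_ereal_sup => _ [h /= hf <-].
have -> : sintegral mu h = \int[mu]_x (h x)%:E.
  by rewrite integral_nnsfun// patch_setT.
exact: fM.
Qed.

End lower_integral_sup.

Section lower_integral.
Local Open Scope ereal_scope.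
Context d (T : measurableType d) (R : realType).
Variable mu : {measure set T -> \bar R}.

(** A measurable minorant [h] of [k * f (phi x)] is transported by [psi] to the measurable minorant
    [k^-1 * h (psi x)] of [f], and [mu_phi] says that the image of [mu] under [phi] is [c] times
    [mu]. Thus [f] itself may be non-measurable. *)
Lemma lower_integral_comp_le (phi psi : T -> T) (c k : R)
  (mphi : measurable_fun setT phi) (mpsi : measurable_fun setT psi)
  (psiK : cancel phi psi) (phiK : cancel psi phi)
  (c0 : (0 < c)%R) (k0 : (0 < k)%R)
  (mu_phi : forall A, measurable A -> mu (phi @^-1` A) = c%:E * mu A)
  (f : T -> \bar R) : (forall x, 0 <= f x) ->
  \int[mu]_x (k%:E * f (phi x)) <= (k * c)%:E * \int[mu]_x f x.
Proof.
move=> f0.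
have kf0 x : 0 <= k%:E * f (phi x) by rewrite mule_ge0// lee_fin ltW.
apply: lower_integral_ge => // h mh h0 hf.
have mhpsi : measurable_fun setT (fun x => (h (psi x))%:E).
  by apply/measurable_EFinP; exact: (measurableT_comp _ mpsi).
have -> : \int[mu]_x (h x)%:E = \int[pushforward mu phi]_x (h (psi x))%:E.
  rewrite ge0_integral_pushforward//=.
    by rewrite preimage_setT; apply: eq_integral => x _ /=; rewrite psiK.
  by move=> y _ /=; rewrite lee_fin.
have -> : \int[pushforward mu phi]_x (h (psi x))%:E =
    \int[mscale (NngNum (ltW c0)) mu]_x (h (psi x))%:E.
  by apply: eq_measure_integral => A mA _; exact: mu_phi.
rewrite ge0_integral_mscale//=; last by move=> x _; rewrite lee_fin.
rewrite mulrC EFinM -muleA lee_pmul2l// ?lte_fin//.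
rewrite (_ : \int[mu]_x (h (psi x))%:E =
    k%:E * \int[mu]_x (k^-1%:E * (h (psi x))%:E)); last first.
  rewrite -ge0_integralZl_EFin ?ltW//; last 2 first.
    by move=> x _; rewrite -EFinM lee_fin mulr_ge0// invr_ge0 ltW.
    by apply: measurable_funeM.
  apply: eq_integral => x _; rewrite -!EFinM mulrA mulfV ?mul1r// gt_eqF//.
rewrite lee_pmul2l ?lte_fin//.
apply: le_lower_integral => x _.
  by rewrite -EFinM lee_fin mulr_ge0// invr_ge0 ltW.
have := hf (psi x); rewrite phiK => hx.
by rewrite muleC lee_pdivrMr// muleC.
Qed.

(** The reverse inequality is the previous one for the inverse map [psi], with the constants [c^-1]
    and [k^-1]. *)
Lemma lower_integral_comp (phi psi : T -> T) (c k : R)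
  (mphi : measurable_fun setT phi) (mpsi : measurable_fun setT psi)
  (psiK : cancel phi psi) (phiK : cancel psi phi)
  (c0 : (0 < c)%R) (k0 : (0 < k)%R)
  (mu_phi : forall A, measurable A -> mu (phi @^-1` A) = c%:E * mu A)
  (f : T -> \bar R) : (forall x, 0 <= f x) ->
  \int[mu]_x (k%:E * f (phi x)) = (k * c)%:E * \int[mu]_x f x.
Proof.
move=> f0; apply/eqP; rewrite eq_le; apply/andP; split.
  exact: (lower_integral_comp_le mphi mpsi).
have kf0 x : 0 <= k%:E * f (phi x) by rewrite mule_ge0// lee_fin ltW.
have mu_psi A : measurable A -> mu (psi @^-1` A) = (c^-1)%:E * mu A.
  move=> mA; have mpA : measurable (psi @^-1` A).
    by rewrite -[X in measurable X]setTI; exact: mpsi.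
  have -> : mu A = mu (phi @^-1` (psi @^-1` A)).
    congr (mu _); apply/seteqP; split => x /=; by rewrite psiK.
  by rewrite mu_phi// muleA -EFinM mulVf ?mul1e// gt_eqF.
have ki0 : (0 < k^-1)%R by rewrite invr_gt0.
have ci0 : (0 < c^-1)%R by rewrite invr_gt0.
have := lower_integral_comp_le mpsi mphi phiK psiK ci0 ki0 mu_psi kf0.
under [in leLHS]eq_integral do
  rewrite phiK muleA -EFinM mulVf ?gt_eqF// mul1e.
rewrite -(@lee_pmul2l _ (k * c)%:E) ?lte_fin ?mulr_gt0//.
by rewrite muleA -EFinM -invfM divff ?mul1e// mulf_neq0 ?gt_eqF.
Qed.

(** Positive and negative parts are scaled separately. The identity covers every [f], integrable or
    not, which is what later gives identities between functionals on all functions. *)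
Lemma Rintegral_comp (phi psi : T -> T) (c k : R)
  (mphi : measurable_fun setT phi) (mpsi : measurable_fun setT psi)
  (psiK : cancel phi psi) (phiK : cancel psi phi)
  (c0 : (0 < c)%R) (k0 : (0 < k)%R)
  (mu_phi : forall A, measurable A -> mu (phi @^-1` A) = c%:E * mu A)
  (f : T -> R) :
  (\int[mu]_x (k * f (phi x)) = k * c * \int[mu]_x f x)%R.
Proof.
rewrite /Rintegral integralE [in RHS]integralE.
rewrite (_ : (fun x => (k * f (phi x))%:E)^\+ =
    (fun x => k%:E * (EFin \o f)^\+ (phi x))); last first.
  apply/funext => x; rewrite !funeposE /= -!EFin_max.
  by rewrite -[in LHS](mulr0 k) -maxr_pMr ?ltW// EFinM.
rewrite (_ : (fun x => (k * f (phi x))%:E)^\- =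
    (fun x => k%:E * (EFin \o f)^\- (phi x))); last first.
  apply/funext => x; rewrite !funenegE /= -!EFin_max.
  by rewrite -[in LHS](mulr0 k) -mulrN -maxr_pMr ?ltW// EFinM.
rewrite !(lower_integral_comp mphi mpsi psiK phiK c0 k0 mu_phi)//.
have kc0 : (0 < k * c)%R by rewrite mulr_gt0.
(* A positive finite factor distributes over the difference even when both terms are infinite. *)
have -> : forall x y : \bar R,
    (k * c)%:E * x - (k * c)%:E * y = (k * c)%:E * (x - y).
  move=> [x||] [y||]; rewrite /= ?gt0_muley ?gt0_muleNy ?lte_fin//.
  by rewrite -!EFinM -EFinB mulrBr.
(* [fine] sends infinite values to 0, which is compatible with the factor. *)
have fineZ : forall x : \bar R, fine ((k * c)%:E * x) = (k * c * fine x)%R.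
  by move=> [x||] //=; rewrite ?gt0_muley ?gt0_muleNy ?lte_fin//= mulr0.
by rewrite fineZ.
Qed.

End lower_integral.

(** * Lebesgue measure under dilations *)

Section lebesgue_scaling.
Variable R : realType.

(** By uniqueness of Lebesgue measure: [a] times the image measure gives half-open intervals their
    length. *)
Lemma lebesgue_measure_scale (a : R) (A : set (measurableTypeR R)) :
  0 < a -> measurable A ->
  lebesgue_measure ((fun x : measurableTypeR R => a * x) @^-1` A) =
  ((a^-1)%:E * lebesgue_measure A)%E.
Proof.
move=> a0 mA.
have mf : measurable_fun setT (fun x : measurableTypeR R => a * x : measurableTypeR R).
  exact: measurable_funM.
pose mu1 : {measure set (measurableTypeR R) -> \bar R} :=
  measure_function_pushforward__canonical__measure_function_Measure
    (lebesgue_measure : {measure set (measurableTypeR R) -> \bar R}) mf.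
pose mu2 := mscale (NngNum (ltW a0)) mu1.
rewrite (@lebesgue_measure_unique R mu2 _ A mA); last first.
  move=> _ [[x y] /= _ <-]; rewrite /mu2 /mscale/= /pushforward.
  have -> : (fun z : measurableTypeR R => a * z) @^-1` `]x, y] =
     `]x / a, y / a]%classic.
    by apply/seteqP; split => z /=; rewrite !in_itv/= ltr_pdivrMr// ler_pdivlMr// mulrC.
  rewrite !lebesgue_measure_itv/= !lte_fin ltr_pM2r ?invr_gt0//.
  case: ifPn => _; last by rewrite mule0.
  rewrite -!EFinB -EFinM -mulrBl mulrCA mulfV ?mulr1 ?gt_eqF//.
by rewrite /mu2 /mscale/= muleA -EFinM mulVf ?mul1e// gt_eqF.
Qed.

End lebesgue_scaling.

Section lebesgue_tuple_scaling.
Variable R : realType.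
Local Notation tup n := (n.-tuple (measurableTypeR R)).

Definition tscale n (a : R) (t : tup n) : tup n :=
  [tuple (a * tnth t i : measurableTypeR R) | i < n].

Lemma measurable_tscale n a : measurable_fun setT (@tscale n a).
Proof.
apply/measurable_fun_tnthP => i.
rewrite (_ : _ \o _ = (fun t : tup n => a * tnth t i : measurableTypeR R)).
  by apply: measurable_funM => //; exact: measurable_tnth.
by apply/funext => t /=; rewrite tnth_mktuple.
Qed.

Lemma tscaleK n a : a != 0 -> cancel (@tscale n a) (tscale a^-1).
Proof.
by move=> a0 t; apply: eq_from_tnth => i; rewrite !tnth_mktuple mulKf.
Qed.

Lemma tscale_cons n a x (t : tup n) :
  tscale a (consT (x, t)) = consT (a * x, tscale a t).
Proof.
apply: eq_from_tnth => i; rewrite tnth_mktuple.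
case: (unliftP ord0 i) => [j|] ->; last by rewrite !(tnth_nth 0).
by rewrite !tnthS tnth_mktuple.
Qed.

(** Induction on the dimension through sections: the section at [x] of the preimage is the preimage
    of the section at [a * x]. The tail contributes [a ^- n] and the head [a^-1]. *)
Lemma lebesgue_tuple_scale n (a : R) : 0 < a -> forall A, measurable A ->
  lebesgue_tuple R n (tscale a @^-1` A) =
  ((a ^- n)%:E * lebesgue_tuple R n A)%E.
Proof.
move=> a0; elim: n => [|n IH] A mA.
  rewrite expr0 invr1 mul1e; congr (lebesgue_tuple R 0 _).
  apply/seteqP; split=> x; by rewrite /= (tuple0 x) (tuple0 (tscale _ _)).
rewrite /= /lebesgue_cons /pushforward/=.
set B := @consT R n @^-1` A.
have mB : measurable B.
  rewrite -[X in measurable X]setTI; exact: measurable_consT.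
set m := lebesgue_tuple R n.
pose g x := m (xsection B x).
have g0 x : (0 <= g x)%E by [].
have mg : measurable_fun setT g by exact: measurable_fun_xsection.
have E : (lebesgue_measure \x m)%E (@consT R n @^-1` (tscale a @^-1` A)) =
  (\int[lebesgue_measure]_x ((a ^- n)%:E * g (a * x)%R))%E.
  apply: eq_integral => x _ /=.
  rewrite -/m -IH; last exact: measurable_xsection.
  congr (m _); apply/seteqP; split => t; rewrite /= /xsection /= !inE /B /= tscale_cons //.
have ai0 : 0 < a^-1 by rewrite invr_gt0.
rewrite E (@lower_integral_comp _ (measurableTypeR R) R lebesgue_measure
  ( *%R a) ( *%R a^-1) a^-1 (a ^- n))//.
- by rewrite -invfM -exprSr.
- by move=> x; rewrite mulKf ?gt_eqF.
- by move=> x; rewrite mulVKf ?gt_eqF.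
- by rewrite invr_gt0 exprn_gt0.
- by move=> C mC; exact: lebesgue_measure_scale.
Qed.

End lebesgue_tuple_scaling.

Section cintegral_scaling.
Variables (R : realType) (n : nat).
Local Notation Rn := 'rV[R]_n.

Lemma of_tuple_tscale (a : R) (t : n.-tuple (measurableTypeR R)) :
  of_tuple (tscale a t) = a *: of_tuple t.
Proof. by apply/rowP => i; rewrite !mxE tnth_mktuple. Qed.

(** The factor [k] stays inside the integral, so that [a = 1] yields homogeneity for arbitrary
    [f]. *)
Lemma cintegral_comp (k a : R) (f : Rn -> R[i]) : 0 < k -> 0 < a ->
  cintegral (fun x => k%:C * f (a *: x)) = (k / a ^+ n)%:C * cintegral f.
Proof.
move=> k0 a0; have an0 : 0 < a ^- n by rewrite invr_gt0 exprn_gt0.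
have a'0 : a^-1 != 0 by rewrite invr_eq0 gt_eqF.
have K1 := @tscaleK R n a (lt0r_neq0 a0).
have K2 := @tscaleK R n a^-1 a'0; rewrite invrK in K2.
have cI := Rintegral_comp (@measurable_tscale R n a) (@measurable_tscale R n a^-1)
  K1 K2 an0 k0 (lebesgue_tuple_scale a0).
rewrite /cintegral.
have -> : (\int[lebesgue_tuple R n]_t complex.Re (k%:C * f (a *: of_tuple t)))%R =
    (k / a ^+ n * \int[lebesgue_tuple R n]_t complex.Re (f (of_tuple t)))%R.
  rewrite -cI; congr (fine _); apply: eq_integral => t _.
  by rewrite of_tuple_tscale; case: (f _) => ? ?; simpc.
have -> : (\int[lebesgue_tuple R n]_t complex.Im (k%:C * f (a *: of_tuple t)))%R =
    (k / a ^+ n * \int[lebesgue_tuple R n]_t complex.Im (f (of_tuple t)))%R.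
  rewrite -cI; congr (fine _); apply: eq_integral => t _.
  by rewrite of_tuple_tscale; case: (f _) => ? ?; simpc.
by simpc.
Qed.

Lemma cintegralZ (k : R) (f : Rn -> R[i]) : 0 < k ->
  cintegral (fun x => k%:C * f x) = k%:C * cintegral f.
Proof.
move=> k0; have := @cintegral_comp k 1 f k0 ltr01.
rewrite expr1n divr1 => <-; congr cintegral; apply/funext => x.
by rewrite scale1r.
Qed.

Lemma cintegral_dilate (a : R) (f : Rn -> R[i]) : 0 < a ->
  cintegral f = (a ^+ n)%:C * cintegral (fun x => f (a *: x)).
Proof.
move=> a0; rewrite -cintegralZ ?exprn_gt0// cintegral_comp ?exprn_gt0//.
by rewrite divff ?mul1r// expf_neq0// gt_eqF.
Qed.

End cintegral_scaling.

(** * Affine changes of variables in Schwartz functions *)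

Section complex_norm.
Variable R : realType.

(** A nonnegative element of [R[i]] has zero imaginary part, so taking the real part of the norm
    loses nothing. *)
Lemma rnormE (V : normedZmodType R[i]) (v : V) : (rnorm v)%:C = `|v|.
Proof.
by rewrite /rnorm; case: `|v| (normr_ge0 v) => a b /= ; rewrite lecE/= => /andP[/eqP->].
Qed.

Lemma rnorm_ge0 (V : normedZmodType R[i]) (v : V) : 0 <= rnorm v.
Proof. by rewrite -ler0c rnormE. Qed.

Lemma rnormD (V : normedZmodType R[i]) (v w : V) : rnorm (v + w) <= rnorm v + rnorm w.
Proof. by rewrite -lecR rmorphD/= !rnormE ler_normD. Qed.

Lemma rnormN (V : normedZmodType R[i]) (v : V) : rnorm (- v) = rnorm v.
Proof. by rewrite /rnorm normrN. Qed.

Lemma rnormB (V : normedZmodType R[i]) (v w : V) : rnorm (v - w) <= rnorm v + rnorm w.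
Proof. by rewrite -[rnorm w]rnormN; exact: rnormD. Qed.

Lemma rnormZ (V : normedModType R[i]) (k : R) (v : V) :
  rnorm (k%:C *: v) = `|k| * rnorm v.
Proof.
apply: (@complexI R); rewrite rmorphM/= !rnormE normrZ; congr (_ * _).
by rewrite normc_def/= expr0n/= addr0 sqrtr_sqr.
Qed.

Lemma rnormM (k : R) (z : R[i]) : rnorm (k%:C * z) = `|k| * rnorm z.
Proof.
apply: (@complexI R); rewrite rmorphM/= !rnormE normrM; congr (_ * _).
by rewrite normc_def/= expr0n/= addr0 sqrtr_sqr.
Qed.

Lemma ReZ (k : R) (z : R[i]) : complex.Re (k%:C * z) = k * complex.Re z.
Proof. by case: z => a b; simpc. Qed.

Lemma ImZ (k : R) (z : R[i]) : complex.Im (k%:C * z) = k * complex.Im z.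
Proof. by case: z => a b; simpc. Qed.

End complex_norm.

Section derive_affine.
Variables (R : realType) (V : normedModType R).

Lemma cvg_dnbhs_scale (c : R) : c != 0 -> (fun h : R => c * h) @ 0^' = 0^'.
Proof.
have sub (a : R) (A : set R) : a != 0 -> 0^' A -> 0^' ((fun h => a * h) @^-1` A).
  move=> a0; rewrite /dnbhs /within /= => /nbhs_ballP[e /= e0 eA].
  apply/nbhs_ballP; exists (e / `|a|) => /=; first by rewrite divr_gt0// normr_gt0.
  move=> h; rewrite /ball/= sub0r normrN ltr_pdivlMr ?normr_gt0// => he h0.
  by apply: eA; rewrite ?mulf_neq0// /ball/= sub0r normrN normrM mulrC.
move=> c0; apply/seteqP; split => A /= hA; last exact: sub.
apply: filterS (sub c^-1 _ (invr_neq0 c0) hA) => h /=.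
by rewrite mulVKf.
Qed.

(** An equality of filters, usable also when the difference quotient has no limit. *)
Lemma fmap_dnbhs_scale (T : Type) (F : R -> T) (c : R) : c != 0 ->
  (F \o (fun h => c * h)) @ 0^' = F @ 0^'.
Proof. by move=> c0; rewrite -[in RHS](cvg_dnbhs_scale c0). Qed.

Variables (f : V -> R) (k c : R) (b : V).
Hypothesis c0 : c != 0.
Let g x := k * f (c *: x + b).

Let quotient_affine (a v : V) :
  (fun h : R => h^-1 *: ((g \o shift a) (h *: v) - g a)) =
  (fun h => (k * c) * h) \o
  (fun h => h^-1 *: ((f \o shift (c *: a + b)) (h *: v) - f (c *: a + b))) \o
  (fun h => c * h).
Proof.
apply/funext => h; rewrite /g /= -mulrBr scalerDr addrA scalerA.
have [->|h0] := eqVneq h 0; first by rewrite !mulr0 !invr0 !scale0r mulr0.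
by rewrite /GRing.scale/= invfM; field; rewrite h0.
Qed.

Lemma derivable_affine a v : derivable f (c *: a + b) v -> derivable g a v.
Proof.
rewrite /derivable quotient_affine => /cvg_ex[l fl].
apply/cvg_ex; exists ((k * c) * l).
rewrite (fmap_dnbhs_scale _ c0).
by apply: cvg_comp fl _; exact: mulrl_continuous.
Qed.

Lemma derive_affine a v : k != 0 -> 'D_v g a = k * c * 'D_v f (c *: a + b).
Proof.
move=> k0; have kc0 : k * c != 0 by rewrite mulf_neq0.
rewrite /derive quotient_affine (fmap_dnbhs_scale _ c0).
set q := (fun h => h^-1 *: _).
have [/cvg_ex[l ql]|nq] := pselect (cvg (q @ 0^')).
  rewrite (cvg_lim _ ql)//; apply: cvg_lim => //.
  by apply: cvg_comp ql _; exact: mulrl_continuous.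
(* Without a limit, both derivatives take the default value 0, so the formula holds for every
   [f]. *)
rewrite (dvgP nq) dvgP ?mulr0// => /cvg_ex[l ql]; apply: nq.
apply/cvg_ex; exists ((k * c)^-1 * l).
have -> : q = (fun h => (k * c)^-1 * h) \o ((fun h => k * c * h) \o q).
  by apply/funext => h /=; rewrite mulKf.
by apply: cvg_comp ql _; exact: mulrl_continuous.
Qed.

End derive_affine.

Section schwartz_affine.
Variables (R : realType) (n : nat).
Local Notation Rn := 'rV[R]_n.

Lemma dotvZl (a : R) (x y : Rn) : dotv (a *: x) y = a * dotv x y.
Proof. by rewrite /dotv mulr_sumr; apply: eq_bigr => i _; rewrite mxE mulrA. Qed.

Lemma dotvZr (a : R) (x y : Rn) : dotv x (a *: y) = a * dotv x y.
Proof. by rewrite /dotv mulr_sumr; apply: eq_bigr => i _; rewrite mxE mulrCA. Qed.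

Lemma dotv_ge0 (x : Rn) : 0 <= dotv x x.
Proof. by apply: sumr_ge0 => i _; rewrite -expr2 sqr_ge0. Qed.

Lemma enormZ (a : R) (x : Rn) : enorm (a *: x) = `|a| * enorm x.
Proof.
by rewrite /enorm dotvZl dotvZr mulrA -expr2 sqrtrM ?sqr_ge0// sqrtr_sqr.
Qed.

Lemma enorm_ge0 (x : Rn) : 0 <= enorm x.
Proof. exact: sqrtr_ge0. Qed.

(** The factor 2 replaces the triangle inequality and spares Cauchy-Schwarz: coordinatewise, the
    square of a difference is at most twice the sum of the squares. *)
Lemma enormB_le (x y : Rn) : enorm (x - y) <= 2 * (enorm x + enorm y).
Proof.
have x0 := enorm_ge0 x; have y0 := enorm_ge0 y.
rewrite -[leRHS]ger0_norm ?mulr_ge0 ?addr_ge0// -sqrtr_sqr ler_wsqrtr//.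
have le2 : dotv (x - y) (x - y) <= 2 * (dotv x x + dotv y y).
  rewrite /dotv -big_split mulr_sumr; apply: ler_sum => i _; rewrite !mxE /=.
  by have := sqr_ge0 (x 0 i + y 0 i); nra.
apply: le_trans le2 _.
rewrite -[dotv x x]sqr_sqrtr ?dotv_ge0// -[dotv y y]sqr_sqrtr ?dotv_ge0//.
by rewrite -/(enorm x) -/(enorm y); nra.
Qed.

(** One family for the dilated test functions and the mollifying kernels; its form is stable under
    partial derivatives, since [k] absorbs the factor [c] of the chain rule. *)
Definition affine_fun (k c : R) (b : Rn) (f : Rn -> R[i]) : Rn -> R[i] :=
  fun x => k%:C * f (c *: x + b).

Lemma partial_affine i k c b f : k != 0 -> c != 0 ->
  partial i (affine_fun k c b f) = affine_fun (k * c) c b (partial i f).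
Proof.
move=> k0 c0; apply/funext => x; rewrite /affine_fun /partial.
have -> : (fun y : Rn => complex.Re (k%:C * f (c *: y + b))) =
    (fun y => k * complex.Re (f (c *: y + b))).
  by apply/funext => y; rewrite ReZ.
have -> : (fun y : Rn => complex.Im (k%:C * f (c *: y + b))) =
    (fun y => k * complex.Im (f (c *: y + b))).
  by apply/funext => y; rewrite ImZ.
rewrite (derive_affine (fun y => complex.Re (f y)) b c0 x _ k0).
rewrite (derive_affine (fun y => complex.Im (f y)) b c0 x _ k0).
by simpc.
Qed.

Lemma partials_affine s k c b f : k != 0 -> c != 0 ->
  partials s (affine_fun k c b f) =
  affine_fun (k * c ^+ size s) c b (partials s f).
Proof.
move=> k0 c0; elim: s => [|i s IH] /=; first by rewrite expr0 mulr1.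
by rewrite IH partial_affine ?mulf_neq0 ?expf_neq0// -mulrA exprSr.
Qed.

Lemma has_partial_affine i k c b f : k != 0 -> c != 0 ->
  has_partial i f -> has_partial i (affine_fun k c b f).
Proof.
move=> k0 c0 hf x; have [fr fi] := hf (c *: x + b); split.
  rewrite (_ : (fun y => _) = (fun y => k * complex.Re (f (c *: y + b)))).
    exact: (@derivable_affine _ _ (fun y => complex.Re (f y)) k c b c0).
  by apply/funext => y; rewrite ReZ.
rewrite (_ : (fun y => _) = (fun y => k * complex.Im (f (c *: y + b)))).
  exact: (@derivable_affine _ _ (fun y => complex.Im (f y)) k c b c0).
by apply/funext => y; rewrite ImZ.
Qed.

(** The cost of replacing the weight at [x] by the weight at [c *: x + b], obtained by writing
    [c *: x] as the difference of [c *: x + b] and [b]. *)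
Definition affine_weight (c : R) (b : Rn) : R :=
  1 + 2 * `|c|^-1 * (1 + enorm b).

Lemma affine_weight_ge0 c b : 0 <= affine_weight c b.
Proof.
by rewrite addr_ge0// !mulr_ge0 ?invr_ge0// addr_ge0// enorm_ge0.
Qed.

Lemma enorm_affine (c : R) (b x : Rn) : c != 0 ->
  1 + enorm x <= affine_weight c b * (1 + enorm (c *: x + b)).
Proof.
move=> c0; have c'0 : 0 < `|c|^-1 by rewrite invr_gt0 normr_gt0.
have : enorm x <= 2 * `|c|^-1 * (enorm (c *: x + b) + enorm b).
  have := enormB_le (c *: x + b) b; rewrite addrK enormZ.
  move=> /(ler_wpM2l (ltW c'0)); rewrite mulKf ?normr_eq0//.
  by rewrite mulrA [_^-1 * 2]mulrC.
have := enorm_ge0 b; have := enorm_ge0 (c *: x + b); rewrite /affine_weight.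
move: (enorm x) (enorm _) (enorm b) => X Y B Y0 B0.
set q := `|c|^-1; rewrite -/q in c'0 *; move=> h.
have : 0 <= q * (B * Y) by rewrite !mulr_ge0 // ltW.
nra.
Qed.

Lemma affine_weighted_le s m k c b f x : k != 0 -> c != 0 ->
  (1 + enorm x) ^+ m * rnorm (partials s (affine_fun k c b f) x) <=
  (`|k| * `|c| ^+ size s * affine_weight c b ^+ m) *
    ((1 + enorm (c *: x + b)) ^+ m * rnorm (partials s f (c *: x + b))).
Proof.
move=> k0 c0; rewrite partials_affine// /affine_fun rnormM normrM normrX.
have /(lerXn2r m) := enorm_affine b x c0.
rewrite !nnegrE addr_ge0 ?enorm_ge0// => /(_ erefl).
rewrite mulr_ge0 ?affine_weight_ge0 ?addr_ge0 ?enorm_ge0// => /(_ erefl).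
rewrite exprMn; move: (_ ^+ m) (_ ^+ m) (_ ^+ m) => X W Y XWY.
rewrite mulrC -!mulrA ler_wpM2l// ler_wpM2l ?exprn_ge0//.
by rewrite mulrC mulrA ler_wpM2r ?rnorm_ge0.
Qed.

Lemma schwartz_affine k c b f : k != 0 -> c != 0 ->
  schwartz f -> schwartz (affine_fun k c b f).
Proof.
move=> k0 c0 [df bf]; split=> [s i|s m].
  by rewrite partials_affine//; apply: has_partial_affine;
    rewrite ?mulf_neq0 ?expf_neq0.
have [B hB] := bf s m.
exists (`|k| * `|c| ^+ size s * affine_weight c b ^+ m * B) => x.
apply: le_trans (affine_weighted_le _ _ _ _ _ k0 c0) _.
by rewrite ler_wpM2l// !mulr_ge0 ?exprn_ge0// affine_weight_ge0.
Qed.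

Lemma schwartz_le_affine N k c b f B : k != 0 -> c != 0 ->
  schwartz_le N f B -> schwartz_le N (affine_fun k c b f)
    (`|k| * (1 + `|c|) ^+ N * affine_weight c b ^+ N * B).
Proof.
move=> k0 c0 fB s x sN; apply: le_trans (affine_weighted_le _ _ _ _ _ k0 c0) _.
apply: ler_pM; last exact: fB.
- by rewrite !mulr_ge0 ?exprn_ge0// affine_weight_ge0.
- by rewrite mulr_ge0 ?exprn_ge0 ?rnorm_ge0// addr_ge0 ?enorm_ge0.
rewrite ler_wpM2r ?exprn_ge0 ?affine_weight_ge0// ler_wpM2l//.
(* The base is at least 1, so its [N]-th power dominates uniformly over derivatives of order at most
   [N]. *)
apply: (@le_trans _ _ ((1 + `|c|) ^+ size s)).
  by rewrite lerXn2r ?nnegrE ?addr_ge0// lerDr.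
by rewrite ler_weXn2l// lerDl.
Qed.

Lemma bump_affine k c f : k != 0 -> c != 0 ->
  Defs.bump f -> Defs.bump (affine_fun k c 0 f).
Proof.
move=> k0 c0 [sf [r fr]]; split; first exact: schwartz_affine.
exists (r / `|c|) => x; rewrite ltr_pdivrMr ?normr_gt0// => rx.
by rewrite /affine_fun addr0 fr ?mulr0// enormZ mulrC.
Qed.

Lemma tempered_scale (u : distr R n) (a : R[i]) phi : tempered u ->
  schwartz phi -> u (fun x => a * phi x) = a * u phi.
Proof.
(* Splitting [a] as [(a - 1) + 1] extracts homogeneity from linearity with [phi] as the second
   function. *)
move=> [lu _] sphi; rewrite (_ : (fun x => _) = (fun x => (a - 1) * phi x + phi x)).
  by rewrite lu// mulrBl mul1r subrK.
by apply/funext => x; rewrite mulrBl mul1r subrK.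
Qed.

Lemma tempered_affine (u : distr R n) (a k c : R) : k != 0 -> c != 0 ->
  tempered u -> tempered (fun phi => a%:C * u (affine_fun k c 0 phi)).
Proof.
move=> k0 c0 [lu [N [K uK]]]; split.
  move=> b phi psi sphi spsi.
  have -> : affine_fun k c 0 (fun x => b * phi x + psi x) =
      (fun x => b * affine_fun k c 0 phi x + affine_fun k c 0 psi x).
    by apply/funext => x; rewrite /affine_fun mulrDr mulrCA.
  by rewrite lu ?mulrDr; [rewrite mulrCA|exact: schwartz_affine..].
exists N, (`|a| * (K * (`|k| * (1 + `|c|) ^+ N *
  affine_weight c (0 : Rn) ^+ N))) => phi B sphi phiB.
rewrite rnormM -[leRHS]mulrA ler_wpM2l// -[leRHS]mulrA.
by apply: uK; [exact: schwartz_affine|exact: schwartz_le_affine].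
Qed.

(** The components of a field in [E] are known only up to [deq]; homogeneity on Schwartz functions
    is inherited from the tempered representative. *)
Lemma tempered_deq (u v : distr R n) (a : R) phi :
  deq u v -> tempered u -> a != 0 -> schwartz phi ->
  v (fun x => a%:C * phi x) = a%:C * v phi.
Proof.
move=> uv tu a0 sphi; rewrite -!uv ?tempered_scale//.
rewrite (_ : (fun x => _) = affine_fun a 1 0 phi).
  by apply: schwartz_affine => //; exact: oner_neq0.
by apply/funext => x; rewrite /affine_fun scale1r addr0.
Qed.

End schwartz_affine.

(** * Dilations of distributions *)

Section dilation.
Variables (R : realType) (n : nat) (lam : R).
Hypothesis lam0 : 0 < lam.
Local Notation Rn := 'rV[R]_n.

Let lamN0 : lam != 0. Proof. exact: lt0r_neq0. Qed.
Let lamV0 : lam^-1 != 0. Proof. exact: invr_neq0. Qed.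

Let lamn_ge0 : 0 <= lam ^- n. Proof. by rewrite invr_ge0 exprn_ge0// ltW. Qed.

Definition rescale (phi : Rn -> R[i]) : Rn -> R[i] :=
  fun x => lam%:C * phi (lam^-1 *: x).

(* Equal to [lam] times [dilate lam u] on Schwartz functions, by linearity; unlike
   the latter, it commutes with the operators below on all functions. *)
Definition scaled_dilate (u : distr R n) : distr R n :=
  fun phi => (lam ^- n)%:C * u (rescale phi).

Lemma rescaleE phi : rescale phi = affine_fun lam lam^-1 0 phi.
Proof. by apply/funext => x; rewrite /affine_fun addr0. Qed.

Lemma schwartz_rescale phi : schwartz phi -> schwartz (rescale phi).
Proof. by rewrite rescaleE; exact: schwartz_affine. Qed.

(** The factor [lam] in [rescale] is there to cancel the one of the chain rule. *)
Lemma partial_rescale i phi :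
  partial i (rescale phi) = (fun x => partial i phi (lam^-1 *: x)).
Proof.
rewrite rescaleE partial_affine// mulfV//.
by apply/funext => x; rewrite /affine_fun mul1r addr0.
Qed.

Lemma tempered_scaled_dilate u : tempered u -> tempered (scaled_dilate u).
Proof.
move=> /(tempered_affine (lam ^- n) lamN0 lamV0).
rewrite (_ : (fun phi => _) = scaled_dilate u)//.
by apply/funext => phi; rewrite /scaled_dilate rescaleE.
Qed.

Lemma comp_scaleE (phi : Rn -> R[i]) :
  (fun x => phi (lam^-1 *: x)) = affine_fun 1 lam^-1 0 phi.
Proof. by apply/funext => x; rewrite /affine_fun mul1r addr0. Qed.

Lemma schwartz_comp_scale (phi : Rn -> R[i]) :
  schwartz phi -> schwartz (fun x => phi (lam^-1 *: x)).
Proof. by rewrite comp_scaleE; apply: schwartz_affine => //; exact: oner_neq0. Qed.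

Lemma tempered_dilate (u : distr R n) : tempered u -> tempered (dilate lam u).
Proof.
move=> /(tempered_affine (lam ^- n) (oner_neq0 R) lamV0).
rewrite (_ : (fun phi => _) = dilate lam u)//.
by apply/funext => phi; rewrite /dilate comp_scaleE.
Qed.

Lemma fourier_rescale phi xi :
  fourier (rescale phi) xi = (lam ^+ n.+1)%:C * fourier phi (lam *: xi).
Proof.
rewrite /fourier (cintegral_dilate _ lam0) exprSr rmorphM/= -mulrA; congr (_ * _).
rewrite -cintegralZ//; congr cintegral; apply/funext => x.
by rewrite /rescale scalerA mulVf// scale1r dotvZl dotvZr mulrCA.
Qed.

Lemma inv_fourier_dilate (psi : Rn -> R[i]) x :
  inv_fourier psi (lam^-1 *: x) =
  (lam ^+ n)%:C * inv_fourier (fun xi => psi (lam *: xi)) x.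
Proof.
rewrite /inv_fourier mulrCA; congr (_ * _).
rewrite (cintegral_dilate _ lam0); congr (_ * cintegral _).
by apply/funext => xi; rewrite dotvZl dotvZr mulrA mulVf// mul1r.
Qed.

(** Both sides evaluate [u] at the same function: dilating the inverse transform and then
    multiplying by [lam] gives [lam ^+ n.+1], as does [fourier_rescale]. *)
Lemma multiplier_scaled_dilate (m : Rn -> R[i]) u phi :
  multiplier m (scaled_dilate u) phi =
  (lam ^- n)%:C * multiplier (fun xi => m (lam *: xi)) u (rescale phi).
Proof.
rewrite /multiplier /scaled_dilate; congr (_ * u _); apply/funext => x.
rewrite /rescale inv_fourier_dilate mulrA -rmorphM/= -exprS mulrCA.
congr (_ * _); rewrite -cintegralZ ?exprn_gt0//; congr cintegral.
apply/funext => xi; rewrite -/(rescale phi) fourier_rescale scalerN.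
by rewrite mulrCA; congr (_ * _); rewrite mulrCA.
Qed.

Lemma riesz_symbolZ j (xi : Rn) : riesz_symbol j (lam *: xi) = riesz_symbol j xi.
Proof.
rewrite /riesz_symbol enormZ mxE gtr0_norm// invfM mulrACA divff ?mul1r//.
Qed.

Lemma cvg_at_right_div : (fun e : R => e / lam) @ 0^'+ --> 0^'+.
Proof.
move=> A; rewrite /at_right /within /= => /nbhs_ballP[e /= e0 eA].
apply/nbhs_ballP; exists (e * lam) => /=; first by rewrite mulr_gt0.
move=> h; rewrite /ball/= sub0r normrN => he h0.
apply: eA; rewrite /ball/= ?divr_gt0//.
by rewrite sub0r normrN normrM normfV (gtr0_norm lam0) ltr_pdivrMr.
Qed.

(** The symbol is homogeneous of degree zero, so dilation only turns the cutoff at scale [eps] into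
    the one at scale [eps / lam], with the same limit. *)
Lemma is_riesz_scaled_dilate j u v :
  is_riesz j u v -> is_riesz j (scaled_dilate u) (scaled_dilate v).
Proof.
move=> [tv uv]; split; first exact: tempered_scaled_dilate.
move=> chi bchi chi1 phi sphi.
have {}uv := uv chi bchi chi1 _ (schwartz_rescale sphi).
pose F e := rnorm (multiplier (fun xi =>
  riesz_symbol j xi * (1 - chi (e^-1 *: xi))) u (rescale phi) - v (rescale phi)).
rewrite [X in X @ _](_ : _ = (fun e => lam ^- n * (F \o (fun e => e / lam)) e)).
  rewrite -[X in _ --> X](mulr0 (lam ^- n)).
  by apply: cvgM; [exact: cvg_cst|exact: cvg_comp cvg_at_right_div uv].
apply/funext => e /=.
rewrite multiplier_scaled_dilate /scaled_dilate -mulrBr rnormM.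
rewrite (ger0_norm lamn_ge0) /F.
rewrite (_ : (fun xi => riesz_symbol j (lam *: xi) * _) = (fun xi =>
    riesz_symbol j xi * (1 - chi ((e / lam)^-1 *: xi))))//.
by apply/funext => xi; rewrite riesz_symbolZ scalerA invfM invrK [_ * lam]mulrC.
Qed.

Lemma is_leray_scaled_dilate (u w : 'I_n -> distr R n) : is_leray u w ->
  is_leray (fun k => scaled_dilate (u k)) (fun k => scaled_dilate (w k)).
Proof.
move=> [r [s [ur rs ws]]].
exists (fun k => scaled_dilate (r k)), (fun k => scaled_dilate (s k)); split.
- by move=> k; exact: is_riesz_scaled_dilate.
- move=> j; have := is_riesz_scaled_dilate (rs j); congr (is_riesz _ _ _).
  by apply/funext => phi; rewrite /scaled_dilate mulr_sumr.
- move=> j phi sphi; rewrite /scaled_dilate ws; last exact: schwartz_rescale.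
  by rewrite mulrBr.
Qed.

Lemma gauss_scale (t : R) (x : Rn) : 0 < t ->
  gauss t (lam^-1 *: x) = (lam ^+ n)%:C * gauss (lam ^+ 2 * t) x.
Proof.
move=> t0; rewrite /gauss -rmorphM/=; congr _%:C; rewrite [RHS]mulrA.
congr (_ * expR _).
  have -> : 4 * pi * (lam ^+ 2 * t) = lam ^+ 2 * (4 * pi * t) by rewrite mulrCA.
  rewrite [in RHS]powRM ?exprn_ge0 ?mulr_ge0 ?pi_ge0 ?(ltW t0) ?(ltW lam0)//.
  suff -> : (lam ^+ 2) `^ (- (n%:R / 2)) = lam ^- n by rewrite mulVKf ?expf_neq0.
  rewrite powRN -powR_mulrn ?(ltW lam0)// -powRrM mulrC divfK ?pnatr_eq0//.
  by rewrite powR_mulrn ?(ltW lam0).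
rewrite dotvZl dotvZr; have := lt0r_neq0 t0 => tN0.
by field; rewrite lamN0 tN0.
Qed.

Lemma convolution_gauss_dilate (t : R) (phi : Rn -> R[i]) x : 0 < t ->
  convolution (gauss t) phi (lam^-1 *: x) =
  convolution (gauss (lam ^+ 2 * t)) (fun y => phi (lam^-1 *: y)) x.
Proof.
move=> t0; rewrite /convolution.
have lV0 : 0 < lam^-1 by rewrite invr_gt0.
rewrite (cintegral_dilate _ lV0) -cintegralZ ?exprn_gt0//; congr cintegral.
apply/funext => y; rewrite -scalerBr gauss_scale// exprVn mulrA mulrA -rmorphM/=.
by rewrite mulVf ?mul1r// expf_neq0.
Qed.

(** Parabolic scaling multiplies the time by [lam ^+ 2]; the derivative supplies the extra [lam]
    that turns [dilate] into [scaled_dilate]. *)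
Lemma dpartial_heat_dilate i (t : R) (F : distr R n) phi : 0 < t ->
  dpartial i (heat t (dilate lam F)) phi =
  scaled_dilate (dpartial i (heat (lam ^+ 2 * t) F)) phi.
Proof.
move=> t0; rewrite /dpartial /heat /dilate /scaled_dilate mulrN.
rewrite partial_rescale.
have E : (fun x => convolution (gauss t) (partial i phi) (lam^-1 *: x)) =
  convolution (gauss (lam ^+ 2 * t)) (fun y => partial i phi (lam^-1 *: y)).
  by apply/funext => x; exact: convolution_gauss_dilate.
by rewrite E.
Qed.

Lemma is_leray_div_heat_dilate (t : R) F w : 0 < t ->
  is_leray_div_heat (lam ^+ 2 * t) F w ->
  is_leray_div_heat t (fun i j => dilate lam (F i j))
    (fun j => scaled_dilate (w j)).
Proof.
move=> t0 /is_leray_scaled_dilate; rewrite /is_leray_div_heat.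
rewrite (_ : (fun k => scaled_dilate _) = (fun j phi =>
  \sum_(i < n) dpartial i (heat t (dilate lam (F i j))) phi))//.
apply/funext => j; apply/funext => phi; rewrite {1}/scaled_dilate mulr_sumr.
by apply: eq_bigr => i _; rewrite dpartial_heat_dilate.
Qed.

(** The dilation is carried by the kernel, again a bump with the same integral, and the parameter
    [eps] is unchanged. *)
Let mollifier (rho : Rn -> R[i]) : Rn -> R[i] := affine_fun (lam ^- n) lam^-1 0 rho.

Lemma mollify_dilate rho (eps : R) (u u' : distr R n) x :
  deq u' u -> tempered u' -> schwartz rho -> 0 < eps ->
  mollify rho eps (dilate lam u) x = mollify (mollifier rho) eps u (lam *: x).
Proof.
move=> uu' tu srho e0; have eN0 := lt0r_neq0 e0; rewrite /mollify /dilate.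
have E : (fun y : Rn => (eps ^- n)%:C * mollifier rho (eps^-1 *: (lam *: x - y))) =
    (fun y => (lam ^- n)%:C *
      affine_fun (eps ^- n) (- (lam * eps)^-1) (eps^-1 *: x) rho y).
  apply/funext => y; rewrite /mollifier /affine_fun mulrCA addr0.
  congr (_ * (_ * rho _)); rewrite scalerA scalerBr scalerA -mulrA mulrCA mulVf//.
  by rewrite mulr1 scaleNr addrC -invfM.
have k0 : eps ^- n != 0 by rewrite invr_eq0 expf_neq0.
have c0 : - (lam * eps)^-1 != 0 by rewrite oppr_eq0 invr_eq0 mulf_neq0.
have lamn0 : lam ^- n != 0 by rewrite invr_eq0 expf_neq0.
(* Pulling [lam ^- n] out of [u] is where linearity enters, through [u']. *)
rewrite E (tempered_deq uu' tu lamn0 (schwartz_affine (eps^-1 *: x) k0 c0 srho)).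
rewrite (_ : affine_fun (eps ^- n) _ _ rho =
  (fun y => (eps ^- n)%:C * rho (eps^-1 *: (x - lam^-1 *: y))))//.
apply/funext => y; rewrite /affine_fun; congr (_ * rho _).
by rewrite scalerBr scalerA scaleNr addrC -invfM mulrC.
Qed.

Lemma bump_mollifier rho : Defs.bump rho -> Defs.bump (mollifier rho).
Proof. by apply: bump_affine => //; rewrite invr_eq0 expf_neq0. Qed.

Lemma cintegral_mollifier rho : cintegral (mollifier rho) = cintegral rho.
Proof.
rewrite /mollifier /affine_fun.
under [X in cintegral X]eq_fun do rewrite addr0.
rewrite cintegral_comp ?invr_gt0 ?exprn_gt0// exprVn divff ?mul1r//.
by rewrite invr_eq0 expf_neq0.
Qed.

(** A product is independent of the mollifier, so its definition may be applied with the dilated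
    kernel and a dilated test function. *)
Lemma is_product_dilate (u v F u' v' : distr R n) :
  deq u' u -> tempered u' -> deq v' v -> tempered v' ->
  is_product u v F -> is_product (dilate lam u) (dilate lam v) (dilate lam F).
Proof.
move=> uu' tu vv' tv [tF uvF]; split; first exact: tempered_dilate.
move=> rho brho rho1 phi sphi.
have {}uvF := uvF _ (bump_mollifier brho) _ _ (schwartz_comp_scale sphi).
have := uvF (etrans (cintegral_mollifier rho) rho1) => {}uvF.
set F' := (fun eps : R => _) in uvF.
have E eps : 0 < eps -> lam ^- n * F' eps = rnorm (regular (fun x =>
    mollify rho eps (dilate lam u) x * mollify rho eps (dilate lam v) x) phi -
    dilate lam F phi).
  move=> e0; rewrite /F' -[dilate lam F phi]/((lam ^- n)%:C * F _).
  rewrite -[X in X * rnorm _](ger0_norm lamn_ge0) -rnormM mulrBr; congr (rnorm (_ - _)).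
  rewrite /regular.
  have lV0 : 0 < lam^-1 by rewrite invr_gt0.
  rewrite [in RHS](cintegral_dilate _ lV0) -exprVn; congr (_ * cintegral _).
  apply/funext => x.
  rewrite (mollify_dilate _ uu' tu brho.1 e0) (mollify_dilate _ vv' tv brho.1 e0).
  by rewrite scalerA mulfV// scale1r.
have h : (fun e => lam ^- n * F' e) @ 0^'+ --> (0 : R).
  rewrite -[X in _ --> X](mulr0 (lam ^- n)).
  by apply: cvgM; [exact: cvg_cst|exact: uvF].
apply: cvg_trans h; apply: near_eq_cvg.
by near=> e; rewrite E.
Unshelve. all: by end_near. Qed.

End dilation.

(** * Norm of a Bochner integral *)

Section bochner_bound.
Context d (T : measurableType d) (R : realType).
Variables (mu : {measure set T -> \bar R}) (V : normedModType R[i]).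
Implicit Types (D : set T) (s : seq (set T * V)).

Lemma simple_fun_cons A (a : V) s x :
  simple_fun ((A, a) :: s) x = (if x \in A then a else 0) + simple_fun s x.
Proof. by rewrite /simple_fun big_cons. Qed.

(* The summand [c] makes the statement stable under splitting [D] along the first
   set of [s], on which [simple_fun s] need not be constant. *)
Lemma simple_fun_integral s D (c : V) :
  (forall Aa, Aa \in s -> measurable Aa.1) ->
  measurable D -> (mu D < +oo)%E ->
  measurable_fun D (fun x => rnorm (c + simple_fun s x)) /\
  ((rnorm ((fine (mu D))%:C *: c +
     \sum_(Aa <- s) (fine (mu (Aa.1 `&` D)))%:C *: Aa.2))%:E <=
   \int[mu]_(x in D) (rnorm (c + simple_fun s x))%:E)%E.
Proof.
elim: s D c => [|[A a] s IH] D c ms mD Doo.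
  split.
    by rewrite (_ : (fun x => _) = cst (rnorm (c + 0)))//;
       apply/funext => x; rewrite /simple_fun big_nil.
  rewrite big_nil addr0.
  rewrite (eq_integral (fun=> (rnorm c)%:E)); last first.
    by move=> x _; rewrite /simple_fun big_nil addr0.
  have fD : mu D \is a fin_num by rewrite ge0_fin_numE.
  rewrite integral_cst// rnormZ (ger0_norm (fine_ge0 (measure_ge0 mu D))).
  by rewrite EFinM (fineK fD) [leRHS]muleC.
have mA : measurable A by apply: (ms (A, a)); rewrite mem_head.
have {}ms Aa : Aa \in s -> measurable Aa.1.
  by move=> Aas; apply: ms; rewrite inE Aas orbT.
have mD1 : measurable (D `&` A) by exact: measurableI.
have mD2 : measurable (D `\` A) by exact: measurableD.
have le1 : (mu (D `&` A) < +oo)%E.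
  by apply: le_lt_trans Doo; rewrite le_measure ?inE//; exact: subIsetl.
have le2 : (mu (D `\` A) < +oo)%E.
  by apply: le_lt_trans Doo; rewrite le_measure ?inE//; exact: subDsetl.
have DE : D = (D `&` A) `|` (D `\` A) by rewrite setUIDK.
have D12 : [disjoint (D `&` A) & (D `\` A)].
  apply/disj_setPS => x /= [[_ Ax] [_]]; exact.
have split_mu B : measurable B -> fine (mu (B `&` D)) =
    fine (mu (B `&` (D `&` A))) + fine (mu (B `&` (D `\` A))).
  move=> mB; rewrite -fineD.
  - rewrite -measureU; first by rewrite -setIUr -DE.
    + exact: measurableI.
    + exact: measurableI.
    + by rewrite setIACA (eqP D12) setI0.
  - rewrite ge0_fin_numE//; apply: le_lt_trans le1.
    by rewrite le_measure ?inE//; exact: measurableI.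
  - rewrite ge0_fin_numE//; apply: le_lt_trans le2.
    by rewrite le_measure ?inE//; exact: measurableI.
(* On the part of [D] inside [A], the value [a] joins the constant summand; outside [A] it is
   absent. *)
have [mf1 I1] := IH _ (c + a) ms mD1 le1.
have [mf2 I2] := IH _ c ms mD2 le2.
have E1 x : x \in D `&` A ->
    rnorm (c + a + simple_fun s x) = rnorm (c + simple_fun ((A, a) :: s) x).
  by rewrite inE => -[_ Ax]; rewrite simple_fun_cons mem_set// addrA.
have E2 x : x \in D `\` A ->
    rnorm (c + simple_fun s x) = rnorm (c + simple_fun ((A, a) :: s) x).
  by rewrite inE => -[_ Ax]; rewrite simple_fun_cons memNset// add0r.
have mf1' := eq_measurable_fun _ E1 mf1.
have mf2' := eq_measurable_fun _ E2 mf2.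
have mf : measurable_fun D (fun x => rnorm (c + simple_fun ((A, a) :: s) x)).
  by rewrite DE; apply/measurable_funU.
split => //.
rewrite [X in integral _ X]DE ge0_integral_setU//=; first last.
- by move=> x _; rewrite lee_fin rnorm_ge0.
- by rewrite -DE; exact/measurable_EFinP.
have J1 : (\int[mu]_(x in D `&` A) (rnorm (c + simple_fun ((A, a) :: s) x))%:E =
    \int[mu]_(x in D `&` A) (rnorm (c + a + simple_fun s x))%:E)%E.
  by apply: eq_integral => x xD; rewrite E1.
have J2 : (\int[mu]_(x in D `\` A) (rnorm (c + simple_fun ((A, a) :: s) x))%:E =
    \int[mu]_(x in D `\` A) (rnorm (c + simple_fun s x))%:E)%E.
  by apply: eq_integral => x xD; rewrite E2.
rewrite J1 J2; apply: le_trans (leeD I1 I2); rewrite -EFinD lee_fin.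
apply: le_trans (rnormD _ _); rewrite big_cons /=.
have -> : \sum_(Aa <- s) (fine (mu (Aa.1 `&` D)))%:C *: Aa.2 =
    \sum_(Aa <- s) (fine (mu (Aa.1 `&` (D `&` A))))%:C *: Aa.2 +
    \sum_(Aa <- s) (fine (mu (Aa.1 `&` (D `\` A))))%:C *: Aa.2.
  rewrite -big_split; apply: eq_big_seq => Aa /ms mAa /=.
  by rewrite split_mu// rmorphD/= scalerDl.
have := split_mu _ measurableT; rewrite !setTI (setIC A D) => ->.
by rewrite rmorphD/= scalerDl scalerDr addrACA [X in _ + X]addrCA addrA.
Qed.

(** The norm of the integral of each approximating simple function is at most the integral of [b]
    plus that of the norm of the error, and the latter tends to 0. *)
Lemma bochner_integral_le D (f : T -> V) (I : V) (b : T -> R) :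
  measurable D -> (mu D < +oo)%E -> bochner_integral mu D f I ->
  measurable_fun D b -> (forall x, D x -> rnorm (f x) <= b x) ->
  ((rnorm I)%:E <= \int[mu]_(x in D) (b x)%:E)%E.
Proof.
move=> mD Doo [s [sD _ sf sI]] mb fb.
have b0 x : D x -> 0 <= b x by move=> Dx; exact: le_trans (rnorm_ge0 _) (fb _ Dx).
have bound k : ((rnorm (\sum_(Aa <- s k) (fine (mu Aa.1))%:C *: Aa.2))%:E <=
   \int[mu]_(x in D) (b x)%:E +
   \int[mu]_(x in D) (rnorm (f x - simple_fun (s k) x))%:E)%E.
  have [|mg] := @simple_fun_integral (s k) D 0 _ mD Doo.
    by move=> Aa /sD[].
  rewrite scaler0 add0r.
  have -> : \sum_(Aa <- s k) (fine (mu (Aa.1 `&` D)))%:C *: Aa.2 =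
            \sum_(Aa <- s k) (fine (mu Aa.1))%:C *: Aa.2.
    by apply: eq_big_seq => Aa /sD[_ AD _]; rewrite setIidl.
  move/le_trans; apply.
  pose g x := rnorm (0 + simple_fun (s k) x).
  (* The measurable excess of the simple function over [b]. It is at most the norm of the error,
     which is not known to be measurable; hence the comparison through [le_lower_integral]. *)
  pose e x := Num.max (g x - b x) 0.
  have me : measurable_fun D e.
    by apply: measurable_maxr => //; exact: measurable_funB.
  apply: (@le_trans _ _ (\int[mu]_(x in D) ((b x)%:E + (e x)%:E))%E).
    apply: ge0_le_integral => //=.
    - by move=> x _; rewrite lee_fin rnorm_ge0.
    - exact/measurable_EFinP.
    - by apply: emeasurable_funD; exact/measurable_EFinP.
    - by move=> x _; rewrite -EFinD lee_fin /e -lerBlDl le_max lexx.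
  rewrite ge0_integralD//=; last 3 first.
  - exact/measurable_EFinP.
  - by move=> x _; rewrite lee_fin le_max lexx orbT.
  - exact/measurable_EFinP.
  rewrite leeD2l//; apply: le_lower_integral => x Dx.
    by rewrite lee_fin le_max lexx orbT.
  rewrite lee_fin ge_max rnorm_ge0 andbT /g add0r.
  rewrite lerBlDr; apply: le_trans (lerD (lexx _) (fb _ Dx)).
  by rewrite addrC -[X in rnorm X <= _](subKr (f x)) rnormB.
apply/lee_addgt0Pr => eps eps0.
have e20 : 0 < eps / 2 by rewrite divr_gt0.
have {}sI : \forall k \near \oo,
    rnorm (I - \sum_(Aa <- s k) (fine (mu Aa.1))%:C *: Aa.2) < eps / 2.
  exact: cvgr_lt sI _ e20.
have {}sf : \forall k \near \oo,
    (\int[mu]_(x in D) (rnorm (f x - simple_fun (s k) x))%:E < (eps / 2)%:E)%E.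
  have e20' : (0 < (eps / 2)%:E)%E by rewrite lte_fin.
  exact: sf (open_ereal_lt' e20').
have [k [/= kI kf]] := filter_ex (filterI sI sf).
apply: (@le_trans _ _ ((eps / 2)%:E + (\int[mu]_(x in D) (b x)%:E + (eps / 2)%:E))%E).
  set S := \sum_(Aa <- s k) (fine (mu Aa.1))%:C *: Aa.2.
  apply: (@le_trans _ _ ((rnorm (I - S))%:E + (rnorm S)%:E)%E).
    by rewrite -EFinD lee_fin -[in leLHS](subrK S I) rnormD.
  apply: leeD; first by rewrite lee_fin ltW.
  apply: le_trans (bound k) _; by rewrite leeD2l// ltW.
by rewrite addeCA -EFinD -splitr.
Qed.

End bochner_bound.

(** * The Beta integral *)

Section beta_integral.
Variable R : realType.
Local Notation mu := (@lebesgue_measure R).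

(** The integrand may blow up at the ends: the fundamental theorem of calculus applies on compact
    subintervals, and monotone convergence passes to their union. *)
Lemma ge0_integral_itvoo_le (f F : R -> R) (a b c : R) : a < b ->
  {in `]a, b[, forall x, 0 <= f x} ->
  {in `]a, b[, forall x : R, derivable f x 1} ->
  {in `]a, b[, forall x : R, is_derive x 1 F (f x)} ->
  (forall x y, a < x -> x <= y -> y < b -> F y - F x <= c) ->
  (\int[mu]_(x in `]a, b[) (f x)%:E <= c%:E)%E.
Proof.
move=> ab f0 df dF Fc; set d := b - a.
have d0 : 0 < d by rewrite subr_gt0.
(* Starting the denominators at 3 makes even the first interval nondegenerate. *)
pose l (i : nat) := a + d / i.+3%:R; pose r (i : nat) := b - d / i.+3%:R.
have di0 i : 0 < d / i.+3%:R by rewrite divr_gt0.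
have di i : d / i.+3%:R * 3 <= d.
  by rewrite mulrAC ler_pdivrMr// ler_wpM2l ?ler_nat// ltW.
have lr i : l i < r i.
  have dE : d = b - a by []; have := di i; have := di0 i; rewrite /l /r.
  by move: (d / _) => e; lra.
have al i : a < l i by rewrite /l ltrDl.
have rb i : r i < b by rewrite /r gtrBl.
pose G i := `[l i, r i]%classic.
have sub i x : x \in `[l i, r i] -> x \in `]a, b[.
  rewrite !in_itv/= => /andP[lx xr].
  by rewrite (lt_le_trans (al i) lx) (le_lt_trans xr (rb i)).
have GE : `]a, b[%classic = \bigcup_i G i.
  apply/seteqP; split=> [x /= xab|x [i _ /=]]; last exact: sub.
  move: xab; rewrite in_itv/= => /andP[ax xb].
  pose e := Num.min (x - a) (b - x).
  have e0 : 0 < e by rewrite lt_min !subr_gt0 ax xb.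
  have [N Nd] : exists N : nat, d / e < N%:R.
    exists (Num.truncn (d / e)).+1; exact: truncnS_gt.
  exists N => //; rewrite /G /= in_itv/= /l /r.
  have : d / N.+3%:R <= e.
    rewrite ler_pdivrMr// -ler_pdivrMl// mulrC (le_trans (ltW Nd))// ler_nat.
    by rewrite -addn3 leq_addr.
  by rewrite /e le_min => /andP[h1 h2]; rewrite -lerBrDl h1/= lerBrDr -lerBrDl.
have cf i : {within `[l i, r i], continuous f}.
  by apply: derivable_within_continuous => x /sub; exact: df.
have dFx x : x \in `]a, b[ -> derivable F x 1 by move=> /dF[].
have mf i : measurable_fun (G i) (EFin \o f).
  by apply/measurable_EFinP; exact: subspace_continuous_measurable_fun (cf i).
have Gle i : (\int[mu]_(x in G i) (f x)%:E <= c%:E)%E.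
  rewrite /G (continuous_FTC2 (lr i) (cf i) (F := F)).
  - by rewrite -EFinB lee_fin Fc// ltW.
  - have cF x : x \in `]a, b[ -> {for x, continuous F}.
      by move=> /dFx /derivable1_diffP /differentiable_continuous.
    split.
    + by move=> x /subset_itv_oo_cc /sub; exact: dFx.
    + apply/cvg_at_right_filter/cF/(sub i).
      by rewrite in_itv/= lexx ltW.
    + apply/cvg_at_left_filter/cF/(sub i).
      by rewrite in_itv/= lexx ltW.
  - move=> x /subset_itv_oo_cc /sub xab; rewrite derive1E.
    by have [_ ->] := dF _ xab.
have ndG : nondecreasing_seq G.
  move=> i j ij; apply/subsetPset => x; rewrite /G /= !in_itv/= => /andP[h1 h2].
  have dij : d / j.+3%:R <= d / i.+3%:R.
    by rewrite ler_wpM2l ?(ltW d0)// lef_pV2 ?posrE// ler_nat.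
  apply/andP; split; first by rewrite (le_trans _ h1)// lerD2l.
  by rewrite (le_trans h2)// lerD2l lerN2.
have h := ge0_nondecreasing_set_cvg_integral (mu := mu) ndG
  (fun i => measurable_itv _) mf
  (fun i x (xG : G i x) => f0 x (sub i x xG) : (0 <= (f x)%:E)%E).
by rewrite GE; apply: (cvge_le _ h); exact: nearW.
Qed.

Lemma integral_powR_le (b t : R) : b < 1 -> 0 < t ->
  (\int[mu]_(x in `]0%R, t[) (x `^ (- b))%:E <= (t `^ (1 - b) / (1 - b))%:E)%E.
Proof.
move=> b1 t0; have b10 : 0 < 1 - b by rewrite subr_gt0.
apply: (@ge0_integral_itvoo_le _ (fun x => (1 - b)^-1 * x `^ (1 - b))) => //.
- by move=> x _; exact: powR_ge0.
- move=> x; rewrite in_itv/= => /andP[x0 _].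
  by have [] := is_derive1_powR (- b) x0.
- move=> x; rewrite in_itv/= => /andP[x0 _].
  have h := is_derive1_powR (1 - b) x0.
  apply: is_derive_eq; rewrite /GRing.scale/= mulrA mulVf ?gt_eqF// mul1r.
  by congr (_ `^ _); rewrite addrAC subrr add0r.
- move=> x y x0 xy yt; rewrite mulrC [X in _ - X]mulrC -mulrBl.
  rewrite ler_pM2r ?invr_gt0// (@le_trans _ _ (y `^ (1 - b)))//.
    by rewrite gerBl powR_ge0.
  by rewrite ge0_ler_powR ?nnegrE ?ltW// (lt_le_trans x0).
Qed.

Lemma integral_powRB_le (b t : R) : b < 1 -> 0 < t ->
  (\int[mu]_(x in `]0%R, t[) ((t - x) `^ (- b))%:E <=
     (t `^ (1 - b) / (1 - b))%:E)%E.
Proof.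
move=> b1 t0; have b10 : 0 < 1 - b by rewrite subr_gt0.
have der (e x : R) : x < t ->
    is_derive x 1 (fun x : R => (t - x) `^ e) (- (e * (t - x) `^ (e - 1))).
  rewrite -subr_gt0 => tx0; have h := is_derive1_powR e tx0.
  have g : is_derive x 1 (fun x : R => t - x) (-1).
    by have := is_deriveB (is_derive_cst t x 1) (is_derive_id x 1); rewrite sub0r.
  by have := @is_derive1_comp _ (@powR R ^~ e) (fun x => t - x) x _ _ h g; rewrite mulrN1.
apply: (@ge0_integral_itvoo_le _ (fun x => - ((1 - b)^-1 * (t - x) `^ (1 - b)))) => //.
- by move=> x _; exact: powR_ge0.
- by move=> x; rewrite in_itv/= => /andP[_ xt]; have [] := der (- b) x xt.
- move=> x; rewrite in_itv/= => /andP[_ xt].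
  have h := der (1 - b) x xt.
  apply: is_derive_eq; rewrite /GRing.scale/= mulrN opprK mulrA mulVf ?gt_eqF// mul1r.
  by congr (_ `^ _); rewrite addrAC subrr add0r.
- move=> x y x0 xy yt; rewrite opprK addrC mulrC [X in _ - X]mulrC -mulrBl.
  have tx : 0 <= t - x by rewrite subr_ge0 (le_trans xy)// ltW.
  rewrite ler_pM2r ?invr_gt0// (@le_trans _ _ ((t - x) `^ (1 - b)))//.
    by rewrite gerBl powR_ge0.
  by rewrite ge0_ler_powR ?nnegrE ?(ltW b10) ?(ltW t0)// gerBl ltW.
Qed.

Lemma ler_powRN (a x y : R) : 0 <= a -> 0 < x -> x <= y -> y `^ (- a) <= x `^ (- a).
Proof.
move=> a0 x0 xy; have y0 := lt_le_trans x0 xy.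
rewrite !powRN lef_pV2 ?posrE ?powR_gt0//.
by rewrite ge0_ler_powR ?nnegrE ?(ltW x0) ?(ltW y0).
Qed.

(** An upper bound for the Beta function at [1 - a] and [1 - b], from cutting the interval at its
    midpoint. *)
Definition beta_bound (a b : R) : R :=
  2^-1 `^ (- a) / (1 - b) + 2^-1 `^ (- b) / (1 - a).

Lemma measurable_powRB (a t : R) (D : set R) :
  measurable_fun D (fun x : R => (t - x) `^ a).
Proof.
have mp : measurable_fun [set: R] (@powR R ^~ a) by exact: measurable_powR.
have mB : measurable_fun D (fun x => t - x) by exact: measurable_funB.
exact: measurableT_comp mp mB.
Qed.

Lemma beta_integral_le (a b t : R) : 0 <= a < 1 -> 0 <= b < 1 -> 0 < t ->
  (\int[mu]_(x in `]0%R, t[) ((t - x) `^ (- a) * x `^ (- b))%:E <=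
   (beta_bound a b * t `^ (1 - a - b))%:E)%E.
Proof.
move=> /andP[a0 a1] /andP[b0 b1] t0.
have t20 : 0 < t / 2 by rewrite divr_gt0.
pose A := (t / 2) `^ (- a); pose B := (t / 2) `^ (- b).
have A0 : 0 <= A by exact: powR_ge0.
have B0 : 0 <= B by exact: powR_ge0.
(* On each half of the interval one factor is at most its value at [t / 2]; the sum of the two
   resulting bounds dominates on both halves. *)
apply: (@le_trans _ _ (\int[mu]_(x in `]0%R, t[)
    (A%:E * (x `^ (- b))%:E + B%:E * ((t - x) `^ (- a))%:E))%E).
  apply: le_lower_integral => x; first by rewrite lee_fin mulr_ge0 ?powR_ge0.
  rewrite /= in_itv/= => /andP[x0 xt]; rewrite -!EFinM -EFinD lee_fin.
  have P1 : 0 <= x `^ (- b) by exact: powR_ge0.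
  have P2 : 0 <= (t - x) `^ (- a) by exact: powR_ge0.
  have [xt2|xt2] := leP x (t / 2).
    apply: ler_wpDr; first exact: mulr_ge0.
    apply: ler_wpM2r => //; apply: ler_powRN => //; lra.
  rewrite mulrC; apply: ler_wpDl; first exact: mulr_ge0.
  by apply: ler_wpM2r => //; apply: ler_powRN => //; exact: ltW.
have m1 : measurable_fun `]0, t[ (fun x : R => (x `^ (- b))%:E).
  by apply/measurable_EFinP; exact: measurable_funTS (measurable_powR _).
have m2 : measurable_fun `]0, t[ (fun x : R => ((t - x) `^ (- a))%:E).
  by apply/measurable_EFinP; exact: measurable_powRB.
rewrite ge0_integralD//=; first last.
- exact: measurable_funeM.
- by move=> x _; rewrite -EFinM lee_fin mulr_ge0 ?powR_ge0.
- exact: measurable_funeM.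
- by move=> x _; rewrite -EFinM lee_fin mulr_ge0 ?powR_ge0.
rewrite !ge0_integralZl_EFin//; first last.
- by move=> x _; rewrite lee_fin powR_ge0.
- by move=> x _; rewrite lee_fin powR_ge0.
apply: le_trans (leeD (lee_wpmul2l _ (integral_powR_le b1 t0))
  (lee_wpmul2l _ (integral_powRB_le a1 t0))) _; rewrite ?lee_fin//.
rewrite /= /A /B /beta_bound.
rewrite !powRM ?(ltW t0)// mulrDl.
have tD (r s : R) : t `^ (r + s) = t `^ r * t `^ s.
  by rewrite powRD// (gt_eqF t0) implybT.
rewrite -addrA [- a - b]addrC !tD.
have bN0 : 1 - b != 0 by rewrite gt_eqF// subr_gt0.
have aN0 : 1 - a != 0 by rewrite gt_eqF// subr_gt0.
by rewrite le_eqVlt; apply/orP; left; apply/eqP; field; rewrite bN0 aN0.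
Qed.

End beta_integral.

(** * The Duhamel term *)

Section norms_of_distributions.
Variables (R : realType) (n : nat) (E : completeNormedModType R[i]).
Variable incl : E -> distr R n.

Section vnorm.
Variable N : distr R n -> \bar R.

Lemma le_vnorm (u : 'I_n -> distr R n) i : (N (u i) <= vnorm N u)%E.
Proof. exact: le_bigmax. Qed.

Lemma vnorm_ge0 (u : 'I_n -> distr R n) : (0 <= vnorm N u)%E.
Proof. exact: bigmax_ge_id. Qed.

Lemma vnorm_le (u : 'I_n -> distr R n) c :
  (0 <= c)%E -> (forall i, (N (u i) <= c)%E) -> (vnorm N u <= c)%E.
Proof. by move=> c0 uc; exact: bigmax_le. Qed.

End vnorm.

Lemma normE_lty u : (normE incl u < +oo)%E -> exists e, deq (incl e) u.
Proof.
move=> /ereal_inf_lt[_ [e eu <-] _]; by exists e.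
Qed.

Hypothesis E_imbedded : imbedded incl.

(** By injectivity of [incl], the infimum runs over a single value. *)
Lemma normE_deq e u : deq (incl e) u -> normE incl u = (rnorm e)%:E.
Proof.
have [_ inj _ _] := E_imbedded => eu; rewrite /normE.
rewrite (_ : [set _ | _ in _] = [set (rnorm e)%:E]) ?ereal_inf1//.
apply/seteqP; split=> [_ [f /= fu <-]|_ ->]; last by exists e.
by rewrite (inj f e) => // phi sphi; rewrite fu// eu.
Qed.

Lemma normE_le u m : (normE incl u <= m%:E)%E ->
  exists2 e, deq (incl e) u & rnorm e <= m.
Proof.
move=> um; have [e eu] := normE_lty (le_lt_trans um (ltry _)).
by exists e => //; rewrite -lee_fin -(normE_deq eu).
Qed.

Lemma inclZ (a : R[i]) e : deq (incl (a *: e)) (fun phi => a * incl e phi).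
Proof.
have [lin _ _ _] := E_imbedded => phi sphi.
have := lin (a - 1) e e phi sphi.
by rewrite scalerBl scale1r subrK mulrBl mul1r subrK.
Qed.

Lemma inclB e f : deq (incl (e - f)) (fun phi => incl e phi - incl f phi).
Proof.
have [lin _ _ _] := E_imbedded => phi sphi.
by rewrite -scaleN1r addrC lin// mulN1r addrC.
Qed.

Lemma deq_dilate lam (u v : distr R n) : 0 < lam -> deq u v -> deq (dilate lam u) (dilate lam v).
Proof.
by move=> lam0 uv phi sphi; rewrite /dilate uv//; exact: schwartz_comp_scale.
Qed.

(** Brings [scaled_dilate] back into [E], where the scaling degree gives its norm. *)
Lemma incl_scaled_dilate (lam : R) e f : 0 < lam ->
  deq (incl f) (dilate lam (incl e)) ->
  deq (incl (lam%:C *: f)) (scaled_dilate lam (incl e)).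
Proof.
have [_ _ temp _] := E_imbedded => lam0 fe phi sphi.
rewrite inclZ// fe// /scaled_dilate /rescale tempered_scale//.
  by rewrite /dilate mulrCA.
exact: schwartz_comp_scale.
Qed.

End norms_of_distributions.

(** * The bilinear estimate for all times *)

Section bilinear_estimate.
Variables (R : realType) (n : nat) (E : completeNormedModType R[i]).
Variable incl : E -> distr R n.
Variable k : R.
Hypothesis E_adequate : adequate incl.
Hypothesis E_scaling : scaling_degree incl (- k).
Hypothesis E_dilation : dilation_stable incl.

(* Dilating to a fixed time [T0 / 2] turns the unspecified [omega] of [adequate]
   into a power of the time, valid for all times. *)
Lemma bilinear_estimate : exists2 K : R, 0 < K &
  forall (f : 'I_n -> distr R n) F (s m : R) (h : 'I_n -> E), 0 < s -> 0 <= m ->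
    (vnorm (normE incl) f <= m%:E)%E -> is_tensor f f F ->
    is_leray_div_heat s F (fun i => incl (h i)) ->
    forall i, rnorm (h i) <= K * s `^ (- ((1 + k) / 2)) * m ^+ 2.
Proof.
have [[E_imb _ _] [_ [T0 [omega [T00 omega0 _ bound]]]]] := E_adequate.
have [_ _ temp _] := E_imb.
pose tau := T0 / 2.
have tau0 : 0 < tau by rewrite divr_gt0.
have tauT : 0 < tau < T0 by rewrite tau0 /= /tau gtr_pMr// invf_lt1// ltr1n.
have om0 := omega0 _ tauT.
(* Normalized so that at [s = tau] the bound reads [omega tau * m ^+ 2]. *)
exists (omega tau * tau `^ ((1 + k) / 2)); first by rewrite mulr_gt0 ?powR_gt0.
move=> f F s m h s0 m0 fm fF hF i.
have st0 : 0 < s / tau by rewrite divr_gt0.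
(* Chosen so that dilation by [lam] carries time [s] to time [tau]. *)
pose lam := (s / tau) `^ 2^-1.
have lam0 : 0 < lam by rewrite powR_gt0.
have lam2 : lam ^+ 2 * tau = s.
  rewrite -powR_mulrn ?(ltW lam0)// -powRrM mulVf ?pnatr_eq0// powRr1 ?(ltW st0)//.
  by rewrite divfK ?gt_eqF.
have fe j : exists2 e, deq (incl e) (f j) & rnorm e <= m.
  by apply: normE_le => //; apply: le_trans fm; exact: le_vnorm.
have fm' : (vnorm (normE incl) (fun j => dilate lam (f j)) <=
    (* [E_dilation] provides the dilated elements of [E], and [E_scaling] their norms. *)
    (lam `^ (- k) * m)%:E)%E.
  apply: vnorm_le => [|j]; first by rewrite lee_fin mulr_ge0// powR_ge0.
  have [e ef em] := fe j; have [e' e'e] := E_dilation e lam0.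
  rewrite (@normE_deq _ _ _ _ E_imb e').
    by rewrite lee_fin (E_scaling lam0 e'e) ler_wpM2l// powR_ge0.
  by move=> phi sphi; rewrite e'e//; exact: deq_dilate.
have f'E : in_E incl (fun j => dilate lam (f j)) by exact: le_lt_trans fm' (ltry _).
have f'F' : is_tensor (fun j => dilate lam (f j)) (fun j => dilate lam (f j))
    (fun i j => dilate lam (F i j)).
  move=> a b; have [ea eaf _] := fe a; have [eb ebf _] := fe b.
  exact: (is_product_dilate lam0 eaf (temp ea) ebf (temp eb)).
rewrite -lam2 in hF.
have [_ /(_ _ (is_leray_div_heat_dilate lam0 tau0 hF)) le_w] :=
  bound _ _ _ tau f'E f'E f'F' tauT.
have [h' h'h] := E_dilation (h i) lam0.
have := le_trans (le_vnorm _ _ i) le_w.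
rewrite (normE_deq E_imb (incl_scaled_dilate E_imb lam0 h'h)) rnormZ gtr0_norm//.
rewrite (E_scaling lam0 h'h) => le_h.
(* The output scales by [lam] to the power [1 - k] and the two inputs together by the power
   [- 2 * k]; what remains is the power [- (1 + k)], where [lam] is the square root of [s / tau]. *)
have {}le_h : lam * (lam `^ (- k) * rnorm (h i)) <=
    omega tau * (lam `^ (- k) * m) ^+ 2.
  rewrite -lee_fin; apply: le_trans le_h _.
  rewrite -muleA expr2 [leRHS]EFinM lee_pmul2l ?lte_fin// EFinM.
  by apply: lee_pmul => //; exact: vnorm_ge0.
pose x := (1 + k) / 2; pose L := lam `^ (- k).
have L0 : 0 < L by rewrite powR_gt0.
have lamE : tau `^ x * s `^ (- x) = lam^-1 * L.
  rewrite -[lam^-1]powR_inv1 ?(ltW lam0)// -powRD ?(gt_eqF lam0) ?implybT//.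
  rewrite -powRrM (_ : 2^-1 * _ = - x); last by rewrite /x; field.
  by rewrite powRM ?invr_ge0 ?ltW// -powR_inv1 ?ltW// -powRrM mulN1r opprK mulrC.
rewrite -(ler_pM2l (mulr_gt0 lam0 L0)) -mulrA; apply: le_trans le_h _.
rewrite -/L -/x -(mulrA (omega tau)) lamE le_eqVlt; apply/orP; left; apply/eqP.
by field; rewrite gt_eqF.
Qed.

End bilinear_estimate.

(** * Decay of the Duhamel integral *)

Section duhamel.
Variables (R : realType) (n : nat) (E : completeNormedModType R[i]).
Variable incl : E -> distr R n.
Variables (k beta : R).
Hypotheses (k_gt0 : 0 < k) (k_lt1 : k < 1) (betaE : beta = 1 - k).
Hypothesis E_adequate : adequate incl.
Hypothesis E_scaling : scaling_degree incl (- k).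
Hypothesis E_dilation : dilation_stable incl.

Lemma weighted_norm_le u (M t : R) : 0 < t ->
  (weighted_norm incl beta u <= M%:E)%E ->
  (vnorm (normE incl) (u t) <= (M * t `^ (- (beta / 2)))%:E)%E.
Proof.
move=> t0 uM; have tb : 0 < t `^ (beta / 2) by rewrite powR_gt0.
rewrite powRN EFinM lee_pdivlMr// muleC; apply: le_trans uM.
by apply: ereal_sup_ubound; exists t.
Qed.

Lemma duhamel_estimate : exists2 K : R, 0 < K &
  forall (u0 : 'I_n -> distr R n) u (M : R), 0 <= M ->
    mild_solution incl u0 u -> (weighted_norm incl beta u <= M%:E)%E ->
  forall t, 0 < t -> exists2 I : 'I_n -> E,
    forall i, deq (u t i) (fun phi => heat t (u0 i) phi - incl (I i) phi) &
    forall i, rnorm (I i) <= K * M ^+ 2 * t `^ (- (beta / 2)).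
Proof.
have [K K0 bil] := bilinear_estimate E_adequate E_scaling E_dilation.
pose a := (1 + k) / 2.
have a01 : 0 <= a < 1.
  apply/andP; split; first by rewrite divr_ge0// addr_ge0// ltW.
  by rewrite ltr_pdivrMr// mul1r -[2]/(1 + 1) ltrD2l.
have b01 : 0 <= beta < 1 by rewrite betaE subr_ge0 (ltW k_lt1) gtrBl.
have bb0 : 0 < beta_bound a beta.
  have /andP[_ a1] := a01; have /andP[_ b1] := b01.
  by rewrite addr_gt0// divr_gt0 ?powR_gt0 ?invr_gt0// subr_gt0.
exists (K * beta_bound a beta); first exact: mulr_gt0.
move=> u0 u M M0 mild uM t t0; have [F [h [I [uF hI uI]]]] := mild t t0.
exists I => // i; pose b (tau : R) :=
  K * M ^+ 2 * ((t - tau) `^ (- a) * tau `^ (- beta)).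
have KM0 : 0 <= K * M ^+ 2 := mulr_ge0 (ltW K0) (exprn_ge0 2 M0).
have mb : measurable_fun `]0, t[ (fun x : R => (t - x) `^ (- a) * x `^ (- beta)).
  apply: measurable_funM; first exact: measurable_powRB.
  exact: measurable_funTS (measurable_powR _).
have tfin : (lebesgue_measure (`]0%R, t[ : set R) < +oo)%E.
  by rewrite lebesgue_measure_itv/= lte_fin t0 -EFinB ltry.
rewrite -lee_fin; apply: (@le_trans _ _
    (\int[lebesgue_measure]_(x in `]0%R, t[) (b x)%:E)%E).
  apply: (bochner_integral_le _ tfin (hI i)) => //.
    by apply: measurable_funM => //; exact: measurable_cst.
  move=> x /=; rewrite in_itv/= => /andP[x0 xt].
  have [tens leray] := uF x (introT andP (conj x0 xt)).
  have tx0 : 0 < t - x by rewrite subr_gt0.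
  have m0 : 0 <= M * x `^ (- (beta / 2)) by rewrite mulr_ge0 ?powR_ge0.
  apply: le_trans (bil _ _ _ _ _ tx0 m0 (weighted_norm_le x0 uM) tens leray i) _.
  rewrite /b -/a exprMn -(powR_mulrn _ (powR_ge0 _ _)) -powRrM mulNr divfK ?pnatr_eq0//.
  by rewrite le_eqVlt; apply/orP; left; apply/eqP; ring.
rewrite /b; under eq_integral do rewrite EFinM.
rewrite ge0_integralZl_EFin//; last first.
- exact/measurable_EFinP.
- by move=> x _; rewrite lee_fin mulr_ge0 ?powR_ge0.
apply: le_trans (lee_wpmul2l _ (beta_integral_le a01 b01 t0)) _.
  by rewrite lee_fin.
rewrite -EFinM lee_fin.
(* The relation [beta = 1 - k] makes the Beta integral decay exactly like the heat flow. *)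
have -> : 1 - a - beta = - (beta / 2) by rewrite /a betaE; field.
by rewrite le_eqVlt; apply/orP; left; apply/eqP; ring.
Qed.

End duhamel.

(** * Decay of the difference of two solutions *)

Theorem theorem3p3 (R : realType) (n : nat) (p beta : R)
    (E : completeNormedModType R[i]) (incl : E -> distr R n)
    (n_ge2 : (2 <= n)%N) (p_gt_n : n%:R < p) (betaE : beta = 1 - n%:R / p)
    (E_adequate : adequate incl)
    (E_scaling : scaling_degree incl (- (n%:R / p)))
    (E_dilation : dilation_stable incl)
    (E_Lq : exists2 q : R, 0 < q & forall t : R, 0 < t -> heat_bounded_Lq incl q t) :
  exists2 C : R, 0 < C &
  forall (u0 v0 : 'I_n -> distr R n)
    (u v : R -> 'I_n -> distr R n) (M : R),
    in_BE incl beta u0 -> in_BE incl beta v0 ->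
    in_chi incl beta u -> in_chi incl beta v ->
    global_solution incl u0 u -> global_solution incl v0 v ->
    0 < M ->
    (norm_chi incl beta u <= M%:E)%E -> (norm_chi incl beta v <= M%:E)%E ->
    let w0 : 'I_n -> distr R n := fun i phi => u0 i phi - v0 i phi in
    let w : R -> 'I_n -> distr R n :=
      fun t i phi => u t i phi - v t i phi in
    (forall t : R, 0 < t ->
       (vnorm (normE incl) (w t) <=
          (vnorm (normBE incl beta) w0 + (4 * C * M ^+ 2)%:E)
            * (t `^ (- (beta / 2)))%:E)%E) /\
    (exists K : R, \forall t \near +oo,
       (vnorm (normE incl) (w t) <= (K * t `^ (- (beta / 2)))%:E)%E).
Proof.
have n0 : (0 : R) < n%:R by rewrite ltr0n (leq_trans _ n_ge2).
have p0 : 0 < p := lt_trans n0 p_gt_n.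
have k0 : 0 < n%:R / p by rewrite divr_gt0.
have k1 : n%:R / p < 1 by rewrite ltr_pdivrMr// mul1r.
have [K K0 duhamel] :=
  duhamel_estimate k0 k1 betaE E_adequate E_scaling E_dilation.
have [[E_imb _ _] _] := E_adequate.
exists K => // u0 v0 u v M _ _ _ _ [_ _ mild_u] [_ _ mild_v] M0 uM vM w0 w.
have {}uM : (weighted_norm incl beta u <= M%:E)%E.
  by apply: le_trans uM; rewrite le_max lexx orbT.
have {}vM : (weighted_norm incl beta v <= M%:E)%E.
  by apply: le_trans vM; rewrite le_max lexx orbT.
split=> [t t0|].
  have tb0 : 0 < t `^ (- (beta / 2)) by rewrite powR_gt0.
  have C0 : 0 <= 4 * K * M ^+ 2.
    by rewrite mulr_ge0 ?exprn_ge0 ?(ltW M0)// mulr_ge0// ltW.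
  have N0 : (0 <= vnorm (normBE incl beta) w0)%E by exact: vnorm_ge0.
  have heat_w0 i : (normE incl (heat t (w0 i)) <=
      vnorm (normBE incl beta) w0 * (t `^ (- (beta / 2)))%:E)%E.
    rewrite powRN lee_pdivlMr ?powR_gt0// muleC.
    apply: le_trans (le_vnorm _ _ i).
    by apply: ereal_sup_ubound; exists t.
  have [I uI I_le] := duhamel u0 u M (ltW M0) mild_u uM t t0.
  have [J vJ J_le] := duhamel v0 v M (ltW M0) mild_v vM t t0.
  (* If the norm of [w0] is infinite, so is the right-hand side, as the power of [t] is positive. *)
  move: (vnorm _ w0) N0 heat_w0 => [N| |] // N0 heat_w0; last first.
    rewrite addye ?gt0_mulye ?lte_fin//; exact: leey.
  apply: vnorm_le => [|i].
    by rewrite -EFinD -EFinM lee_fin; exact: mulr_ge0 (addr_ge0 N0 C0) (ltW tb0).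
  (* [e] represents the heat flow of [w0]; subtracting the two Duhamel formulas leaves
     [I i - J i]. *)
  have [e ew0 eN] := normE_le E_imb (heat_w0 i).
  have ew : deq (incl (e - (I i - J i))) (w t i).
    move=> phi sphi; rewrite !(inclB E_imb)// ew0// /w uI// vJ//.
    by rewrite /heat /w0; ring.
  rewrite (normE_deq E_imb ew) -EFinD -EFinM lee_fin.
  apply: le_trans (rnormB _ _) _.
  have := lerD eN (le_trans (rnormB _ _) (lerD (I_le i) (J_le i))).
  move/le_trans; apply; rewrite mulrDl lerD2l -mulrDl ler_wpM2r ?(ltW tb0)//.
  (* The two integrals contribute only [2 * K * M ^+ 2], half of what is allowed. *)
  by move: C0; set x := K * M ^+ 2; rewrite -mulrA -/x => C0; lra.
(* The asymptotic statement follows directly from the weighted bounds on [u] and [v], whatever the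
   norm of [w0]. *)
exists (2 * M); near=> t.
have t0 : 0 < t by near: t; exact: nbhs_pinfty_gt.
have tb0 : 0 < t `^ (- (beta / 2)) by rewrite powR_gt0.
apply: vnorm_le => [|i].
  by rewrite lee_fin; exact: mulr_ge0 (mulr_ge0 (ler0n _ 2) (ltW M0)) (ltW tb0).
have [e eu eM] := normE_le E_imb (le_trans (le_vnorm _ _ i) (weighted_norm_le t0 uM)).
have [f fv fM] := normE_le E_imb (le_trans (le_vnorm _ _ i) (weighted_norm_le t0 vM)).
have ew : deq (incl (e - f)) (w t i).
  by move=> phi sphi; rewrite (inclB E_imb)// eu// fv.
rewrite (normE_deq E_imb ew) lee_fin; apply: le_trans (rnormB _ _) _.
by rewrite -mulrA mulr2n mulrDl mul1r lerD.
Unshelve. all: by end_near. Qed.
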